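(* Let $L,B\in(0,\infty)$, $H\in[0,\infty]$ and integers $N\ge D\ge 1$. Let $\mathcal G$ be any oracle graph of depth $D$ and size $N$, and consider algorithms for $(\mathcal G,\mathcal O_{\mathrm{grad}},\mathcal F_{L,H,B})$. There is a universal constant $c_0>0$ such that for every (possibly randomized) algorithm $\mathcal A=(R_1,\dots,R_N,\hat X)$ there exist a dimension $m=O\big(\max\{N^2,D^3N\}\log(DN)\big)$, a distribution $\mathcal P$ and a function $f:\mathbb R^m\times\mathcal Z\to\mathbb R$ with $f(\cdot;z)$ convex, $L$-Lipschitz and $H$-smooth on $\{x\in\mathbb R^m:\|x\|\le B\}$ for every $z$, such that the output $\hat x$ of $\mathcal A$ satisfies \[ \mathbb E_{\hat x\sim\mathcal A,\,z\sim\mathcal P}\big[f(\hat x;z)\big]-\min_{\|x\|\le B}\mathbb E_{z\sim\mathcal P}\big[f(x;z)\big]\ \ge\ c_0\left(\min\Big\{\frac{LB}{\sqrt D},\ \frac{HB^2}{D^2}\Big\}+\frac{LB}{\sqrt N}\right). \]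
   Context: Stochastic optimization problem: minimize $F(x)=\mathbb E_{z\sim\mathcal P}[f(x;z)]$ over $\{x\in\mathbb R^m:\|x\|\le B\}$. $\mathcal F_{L,H,B}$ is the class of such problems where for every $z$, $f(\cdot;z)$ is convex, $L$-Lipschitz, and $H$-smooth (differentiable with $H$-Lipschitz gradient; $H=\infty$ means no smoothness is required) on the $B$-ball. The stochastic gradient oracle is $\mathcal O_{\mathrm{grad}}(x,z)=(f(x;z),\nabla f(x;z))$. An oracle graph $\mathcal G$ is a finite directed acyclic graph with nodes $v_1,\dots,v_N$; its size is $N$ and its depth $D$ is the maximal number of nodes on a directed path. An algorithm for $(\mathcal G,\mathcal O,\mathcal F)$ assigns to each node $v_t$ a query rule $R_t$ that maps the list of (queries, oracle responses) at all ancestors of $v_t$, together with a shared random seed $\xi$, to a query $q_t$ (here a point $x$ with $\|x\|\le B$), and an output rule $\hat X$ mapping all $N$ queries and responses and $\xi$ to an output $\hat x$ with $\|\hat x\|\le B$. Each oracle response at a node is computed at an independently drawn $z\sim\mathcal P$ (the bound also holds if the algorithm may instead choose the $z$ at which a query is answered). *)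

(* Defs.v *)
From HB Require Import structures.
From mathcomp Require Import all_boot all_order all_algebra.
From mathcomp Require Import all_classical all_reals all_analysis.
Set Implicit Arguments. Unset Strict Implicit. Unset Printing Implicit Defensive.
Import Order.TTheory GRing.Theory Num.Theory.
Local Open Scope classical_set_scope.
Local Open Scope ring_scope.

(* Euclidean space R^m (row vectors) with its Borel sigma-algebra, i.e. the  *)
(* sigma-algebra generated by the coordinate maps.                           *)
Definition vec (R : realType) (m : nat) : Type := 'rV[R]_m.

HB.instance Definition _ (R : realType) (m : nat) :=
  Choice.on (vec R m).
HB.instance Definition _ (R : realType) (m : nat) :=
  isPointed.Build (vec R m) 0.

Definition vec_coord (R : realType) (m : nat) (i : 'I_m) (x : vec R m) : R :=
  x ord0 i.

Definition vec_display : measure_display -> measure_display.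
Proof. exact. Qed.

Section vec_measurable.
Variables (R : realType) (m : nat).
Let vec_set0 : g_sigma_preimage (@vec_coord R m) set0.
Proof. exact: sigma_algebra0. Qed.
Let vec_setC A : g_sigma_preimage (@vec_coord R m) A ->
  g_sigma_preimage (@vec_coord R m) (~` A).
Proof. by move=> hA; rewrite -setTD; exact: sigma_algebraCD. Qed.
Let vec_bigcup (F : _^nat) :
  (forall i, g_sigma_preimage (@vec_coord R m) (F i)) ->
  g_sigma_preimage (@vec_coord R m) (\bigcup_i (F i)).
Proof. exact: sigma_algebra_bigcup. Qed.
HB.instance Definition _ :=
  @isMeasurable.Build (vec_display default_measure_display)
  (vec R m) (g_sigma_preimage (@vec_coord R m)) vec_set0 vec_setC vec_bigcup.
End vec_measurable.

Section defs.
Variable R : realType.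

Definition dotv (m : nat) (x y : vec R m) : R :=
  \sum_(i < m) x ord0 i * y ord0 i.
Definition enorm (m : nat) (x : vec R m) : R :=
  Num.sqrt (\sum_(i < m) x ord0 i ^+ 2).
Definition eball (m : nat) (B : R) : set (vec R m) := [set x | enorm x <= B].

Definition is_gradient (m : nat) (phi : vec R m -> R) (x gr : vec R m) :=
  forall e : R, 0 < e -> exists2 d : R, 0 < d &
    forall y, enorm (y - x) < d ->
      `|phi y - phi x - dotv gr (y - x)| <= e * enorm (y - x).

(* The class F_{L,H,B}: for every z, f(.;z) is convex, L-Lipschitz on the
   B-ball, and g(.;z) is the first-order oracle (a subgradient of f(.;z) on the
   ball); if H < +oo then f(.;z) is differentiable on the ball with gradient
   g(.;z), which is H-Lipschitz on the ball. *)
Definition in_class (L B : R) (H : \bar R) (m : nat) (Z : Type)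
    (f : vec R m -> Z -> R) (g : vec R m -> Z -> vec R m) : Prop :=
  forall z : Z,
  [/\ (forall x y, eball B x -> eball B y ->
         `|f x z - f y z| <= L * enorm (x - y)),
      (forall x y (t : R), eball B x -> eball B y -> 0 <= t <= 1 ->
         f (t *: x + (1 - t) *: y) z <= t * f x z + (1 - t) * f y z),
      (forall x y, eball B x -> eball B y ->
         f x z + dotv (g x z) (y - x) <= f y z) &
      (forall h : R, H = h%:E ->
         (forall x, eball B x -> is_gradient (f^~ z) x (g x z)) /\
         (forall x y, eball B x -> eball B y ->
            enorm (g x z - g y z) <= h * enorm (x - y)))].

Definition dag (N : nat) (G : rel 'I_N) : Prop :=
  forall t, ~~ [exists u, G t u && connect G u t].
Definition ancestor (N : nat) (G : rel 'I_N) (s t : 'I_N) : bool :=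
  [exists u, G s u && connect G u t].
(* depth = maximal number of nodes on a directed path (x :: p has
   (size p).+1 nodes). *)
Definition has_depth (N : nat) (G : rel 'I_N) (D : nat) : Prop :=
  (exists x p, path G x p /\ (size p).+1 = D) /\
  (forall x p, path G x p -> ((size p).+1 <= D)%N).

(* A history: for each node s, the query q_s and the oracle response
   (f(q_s;z_s), grad f(q_s;z_s)). *)
Definition hist (N m : nat) := N.-tuple (vec R m * (R * vec R m)).

(* An algorithm for (G, O_grad, F_{L,H,B}), for every dimension m: query rules
   and output rule with shared seed xi drawn from mu; queries and outputs lie
   in the B-ball, the rule at t depends only on the data at ancestors of t,
   and all rules are (jointly) measurable. *)
Definition is_algorithm (N : nat) (G : rel 'I_N) (B : R)
    (dX : measure_display) (Xi : measurableType dX)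
    (Rule : forall m, 'I_N -> hist N m -> Xi -> vec R m)
    (Xhat : forall m, hist N m -> Xi -> vec R m) : Prop :=
  [/\ (forall m t h xi, enorm (Rule m t h xi) <= B),
      (forall m h xi, enorm (Xhat m h xi) <= B),
      (forall m t (h h' : hist N m) xi,
         (forall s, ancestor G s t -> tnth h s = tnth h' s) ->
         Rule m t h xi = Rule m t h' xi),
      (forall m t, measurable_fun setT
         (fun p : hist N m * Xi => Rule m t p.1 p.2)) &
      (forall m, measurable_fun setT
         (fun p : hist N m * Xi => Xhat m p.1 p.2))].

Section execution.
Variables (N m : nat) (dX : measure_display) (Xi : measurableType dX)
  (dZ : measure_display) (Z : measurableType dZ).
Variables (Rule : 'I_N -> hist N m -> Xi -> vec R m)
  (Xhat : hist N m -> Xi -> vec R m)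
  (f : vec R m -> Z -> R) (g : vec R m -> Z -> vec R m).

Definition mk_hist (q : 'I_N -> vec R m) (zs : 'I_N -> Z) : hist N m :=
  [tuple (q s, (f (q s) (zs s), g (q s) (zs s))) | s < N].

(* The queries of the execution with seed xi and samples zs: the unique
   solution of q_t = R_t(history at ancestors of t, xi), obtained by
   iterating N >= depth times. *)
Definition run (xi : Xi) (zs : 'I_N -> Z) : 'I_N -> vec R m :=
  iter N (fun q t => Rule t (mk_hist q zs) xi) (fun _ => 0).

Definition output (xi : Xi) (zs : 'I_N -> Z) : vec R m :=
  Xhat (mk_hist (run xi zs) zs) xi.

Fixpoint iid_expect (P : probability Z R) (n : nat)
    (F : seq Z -> \bar R) : \bar R :=
  if n is n'.+1 then (\int[P]_z iid_expect P n' (fun s => F (z :: s)))%E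
  else F [::].

Definition expected_loss (mu : probability Xi R) (P : probability Z R) : \bar R :=
  (\int[mu]_xi iid_expect P N (fun zs =>
      \int[P]_z (f (output xi (fun s => nth point zs s)) z)%:E))%E.

Definition opt_value (B : R) (P : probability Z R) : \bar R :=
  ereal_inf [set (\int[P]_z (f x z)%:E)%E | x in eball B].
End execution.
End defs.

(* Main.v *)
(** The larger of the two terms is bounded from below on its own.

    Statistical term: with 4N+1 coordinates, f(x;z) = L sigma_z x_z for a uniform
    coordinate z and random signs sigma. The output is independent of the signs of
    the coordinates that were not sampled, and N sampled coordinates contribute at
    least -L B sqrt N / (4N+1).

    Optimization term: a deterministic smooth maximum of D+1 functionals
    <v_r, x> - r gamma, where v_r is a normalized random sign vector supported on the
    r-th block of coordinates. The maximum is nested, M_r = a_r + eta(M_{r+1} - a_r)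
    with a_r = <v_r, x> - r gamma and eta(s) = s^2 / (delta + s) for s > 0, eta(s) = 0
    for s <= 0. Since eta'' <= 2 (1 - eta') / delta, the Hessians of the nested maxima
    average out and M_0 is O(1/delta)-smooth, uniformly in D; since eta vanishes on
    the negative axis, the oracle answer at a point nearly orthogonal to v_r for all
    r >= d only depends on v_0, ..., v_d. A node of level d (longest path ending
    there) therefore knows v_0, ..., v_{d-1} only, and by Hoeffding's bound its query
    is nearly orthogonal to all later v_r; so is the output to v_D. *)
Require Import Defs.
From HB Require Import structures.
From mathcomp Require Import all_boot all_order all_algebra.
From mathcomp Require Import all_classical all_reals all_analysis.
From mathcomp Require Import measurable_realfun.
From mathcomp Require Import ring lra.
Set Implicit Arguments. Unset Strict Implicit. Unset Printing Implicit Defensive.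
Import Order.TTheory GRing.Theory Num.Theory.
Local Open Scope classical_set_scope.
Local Open Scope ring_scope.

(** * Euclidean space and smooth convex functions *)

Section euclidean.
Context {R : realType} {m : nat}.
Implicit Types (x y z : vec R m) (a : R).

Lemma dotvC x y : dotv x y = dotv y x.
Proof. by apply: eq_bigr => i _; rewrite mulrC. Qed.

Lemma dotvDr x y z : dotv x (y + z) = dotv x y + dotv x z.
Proof. by rewrite -big_split/=; apply: eq_bigr => i _; rewrite mxE mulrDr. Qed.

Lemma dotvZr a x y : dotv x (a *: y) = a * dotv x y.
Proof. by rewrite mulr_sumr; apply: eq_bigr => i _; rewrite mxE mulrCA. Qed.

Lemma dotvNr x y : dotv x (- y) = - dotv x y.
Proof. by rewrite -scaleN1r dotvZr mulN1r. Qed.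

Lemma dotvBr x y z : dotv x (y - z) = dotv x y - dotv x z.
Proof. by rewrite dotvDr dotvNr. Qed.

Lemma dotvDl x y z : dotv (y + z) x = dotv y x + dotv z x.
Proof. by rewrite dotvC dotvDr !(dotvC x). Qed.

Lemma dotvZl a x y : dotv (a *: y) x = a * dotv y x.
Proof. by rewrite dotvC dotvZr (dotvC x). Qed.

Lemma dotvBl x y z : dotv (y - z) x = dotv y x - dotv z x.
Proof. by rewrite dotvC dotvBr !(dotvC x). Qed.

Lemma dotvv_ge0 x : 0 <= dotv x x.
Proof. by apply: sumr_ge0 => i _; rewrite -expr2 sqr_ge0. Qed.

Lemma enorm_ge0 x : 0 <= enorm x.
Proof. exact: sqrtr_ge0. Qed.

Lemma enorm_sqr x : enorm x ^+ 2 = dotv x x.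
Proof.
rewrite /enorm sqr_sqrtr; first by apply: eq_bigr => i _; rewrite expr2.
by apply: sumr_ge0 => i _; rewrite sqr_ge0.
Qed.

Lemma dotv0r x : dotv x 0 = 0.
Proof. by apply: big1 => i _; rewrite mxE mulr0. Qed.

Lemma enorm0 : enorm (0 : vec R m) = 0.
Proof. by apply/eqP; rewrite -sqrf_eq0 enorm_sqr dotv0r. Qed.

Lemma enormZ a x : enorm (a *: x) = `|a| * enorm x.
Proof.
rewrite /enorm -sqrtr_sqr -sqrtrM ?sqr_ge0// mulr_sumr; congr Num.sqrt.
by apply: eq_bigr => i _; rewrite mxE exprMn.
Qed.

Lemma enormN x : enorm (- x) = enorm x.
Proof. by rewrite -scaleN1r enormZ normrN1 mul1r. Qed.

Lemma enormB x y : enorm (x - y) = enorm (y - x).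
Proof. by rewrite -opprB enormN. Qed.

(** Cauchy-Schwarz, from the nonnegative square of the component of [x] orthogonal to [y]. A null
    [y] is treated apart, since the projection coefficient divides by [dotv y y]. *)
Lemma dotv_le_enorm x y : dotv x y <= enorm x * enorm y.
Proof.
have [y0|y0] := eqVneq (dotv y y) 0.
  suff -> : dotv x y = 0 by rewrite mulr_ge0// enorm_ge0.
  apply: big1 => i _; suff -> : y ord0 i = 0 by rewrite mulr0.
  apply/eqP; rewrite -sqrf_eq0; have /eqP := y0; rewrite psumr_eq0 => [/allP|j _]; last first.
    by rewrite -expr2 sqr_ge0.
  by move=> /(_ i); rewrite mem_index_enum expr2 => /(_ isT).
have y1 : 0 < dotv y y by rewrite lt_def y0 dotvv_ge0.
set t := dotv x y / dotv y y.
have := mulr_ge0 (ltW y1) (dotvv_ge0 (x - t *: y)).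
rewrite !(dotvBr, dotvBl, dotvZr, dotvZl) (dotvC y x).
have -> : dotv y y * (dotv x x - t * dotv x y - t * (dotv x y - t * dotv y y))
    = dotv x x * dotv y y - dotv x y ^+ 2 by rewrite /t; field.
move=> h; apply: le_trans (ler_norm _) _.
rewrite -ler_sqr ?nnegrE ?mulr_ge0 ?enorm_ge0// exprMn !enorm_sqr.
by rewrite real_normK ?num_real//; lra.
Qed.

Lemma norm_dotv_le x y : `|dotv x y| <= enorm x * enorm y.
Proof.
rewrite ler_norml dotv_le_enorm andbT lerNl -dotvNr -(enormN y).
exact: dotv_le_enorm.
Qed.

Lemma enorm_le1_dual x : (forall d, dotv x d <= enorm d) -> enorm x <= 1.
Proof.
move=> /(_ x); rewrite -enorm_sqr; have := enorm_ge0 x.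
by rewrite le_eqVlt => /orP[/eqP<-//|h]; rewrite expr2 -ler_pdivlMr// divff ?gt_eqF.
Qed.

Lemma enormD x y : enorm (x + y) <= enorm x + enorm y.
Proof.
rewrite -ler_sqr ?nnegrE ?addr_ge0 ?enorm_ge0// enorm_sqr.
rewrite !(dotvDr, dotvDl) (dotvC y x) sqrrD !enorm_sqr.
by have := dotv_le_enorm x y; lra.
Qed.

End euclidean.

(** * Smoothness from a subgradient bound and a local quadratic upper bound *)

Section smooth_convex.
Context {R : realType} {m : nat}.
Variables (F : vec R m -> R) (g : vec R m -> vec R m) (K : R).
Hypothesis F_lower : forall x y, F x + dotv (g x) (y - x) <= F y.

(** In the weighted average of the two subgradient inequalities at the intermediate point, the
    linear terms cancel. *)
Lemma subgradient_convex x y t : 0 <= t <= 1 ->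
  F (t *: x + (1 - t) *: y) <= t * F x + (1 - t) * F y.
Proof.
move=> /andP[t0 t1]; set z := _ + _.
have hx : x - z = (1 - t) *: (x - y) by apply/rowP => i; rewrite !mxE; ring.
have hy : y - z = - t *: (x - y) by apply/rowP => i; rewrite !mxE; ring.
have := F_lower z x; rewrite hx dotvZr => h1.
have := F_lower z y; rewrite hy dotvZr => h2.
have : t * (F z + (1 - t) * dotv (g z) (x - y)) <= t * F x by apply: ler_wpM2l.
have : (1 - t) * (F z + - t * dotv (g z) (x - y)) <= (1 - t) * F y.
  by apply: ler_wpM2l => //; lra.
lra.
Qed.

Variable rho : R.
Hypothesis F_upper : forall x y, enorm (y - x) <= rho ->
  F y <= F x + dotv (g x) (y - x) + K / 2 * enorm (y - x) ^+ 2.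
Hypothesis K_gt0 : 0 < K.
Hypothesis rho_gt0 : 0 < rho.

Lemma smooth_is_gradient x : is_gradient F x (g x).
Proof.
move=> e e0; exists (Num.min rho (e / K)); first by rewrite lt_min rho_gt0 divr_gt0.
move=> y; rewrite lt_min ltr_pdivlMr// => /andP[hr hy].
rewrite ger0_norm; last by have := F_lower x y; lra.
have := F_upper (ltW hr); have := enorm_ge0 (y - x); nra.
Qed.

Hypothesis g_step : forall x y, enorm (g x - g y) <= K * rho.

(* Co-coercivity: apply the upper bound to a gradient step from y on
   F - <g x, .>, which x minimizes. *)
Let cocoercive x y :
  F x + dotv (g x) (y - x) + (2 * K)^-1 * enorm (g y - g x) ^+ 2 <= F y.
Proof.
set d := g y - g x; pose z := y - K^-1 *: d.
have hz : z - y = - K^-1 *: d by apply/rowP => i; rewrite !mxE; ring.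
have hx : z - x = (y - x) + - K^-1 *: d by apply/rowP => i; rewrite !mxE; ring.
(* The upper bound is only assumed within distance [rho]; [g_step] keeps the gradient step inside
   that radius. *)
have zy : enorm (z - y) <= rho.
  by rewrite hz enormZ normrN gtr0_norm ?invr_gt0// ler_pdivrMl// g_step.
have := F_upper zy; rewrite hz dotvZr enormZ exprMn (@real_normK _ (- K^-1)) ?num_real//.
have := F_lower x z; rewrite hx dotvDr dotvZr.
have -> : enorm d ^+ 2 = dotv (g y) d - dotv (g x) d by rewrite enorm_sqr {1}/d dotvBl.
have -> : K / 2 * ((- K^-1) ^+ 2 * (dotv (g y) d - dotv (g x) d)) =
  (2 * K)^-1 * (dotv (g y) d - dotv (g x) d) by field; rewrite gt_eqF.
have -> : K^-1 = 2 * (2 * K)^-1 by field; rewrite gt_eqF.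
lra.
Qed.

(** Adding co-coercivity for [(x, y)] and [(y, x)] bounds [K^-1 * u ^+ 2] by the inner product of
    the gradient difference with [x - y], hence by [u * w]; then divide by [u]. *)
Lemma smooth_lipschitz_gradient x y : enorm (g x - g y) <= K * enorm (x - y).
Proof.
have := cocoercive x y; have := cocoercive y x.
rewrite (enormB (g y) (g x)).
have -> : y - x = - (x - y) by rewrite opprB.
rewrite dotvNr; have := dotv_le_enorm (g x - g y) (x - y).
rewrite dotvBl; set u := enorm (g x - g y); set w := enorm (x - y) => h1 h2 h3.
have {}h : K^-1 * u ^+ 2 <= u * w.
  have -> : K^-1 = (2 * K)^-1 + (2 * K)^-1 by field; rewrite gt_eqF.
  by lra.
have u0 : 0 <= u by exact: enorm_ge0.
move: h; rewrite mulrC ler_pdivrMr// => h.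
have [->|un0] := eqVneq u 0; first by rewrite mulr_ge0 ?enorm_ge0// ltW.
have up : 0 < u by rewrite lt_def un0.
by rewrite -(ler_pM2l up) -expr2 mulrA mulrAC (le_trans h)// mulrAC mulrC mulrA mulrC.
Qed.

End smooth_convex.

(** * A smoothed positive part that vanishes on the negative axis *)

Section softplus.
Context {R : realType}.
Variable delta : R.
Hypothesis delta_gt0 : 0 < delta.
Implicit Types s t : R.

(** The function [eta] of the overview. It lies between the positive part of [s] lowered by [delta]
    and the positive part itself. *)
Definition softplus s : R := if s <= 0 then 0 else s ^+ 2 / (delta + s).
(** The derivative of [softplus], written so that [1 - dsoftplus s] is a square on the positive
    axis. *)
Definition dsoftplus s : R := if s <= 0 then 0 else 1 - (delta / (delta + s)) ^+ 2.

Lemma dsoftplus_ge0 s : 0 <= dsoftplus s.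
Proof.
have d0 := delta_gt0.
rewrite /dsoftplus; case: (lerP s 0) => // s0.
have ds : 0 < delta + s by lra.
rewrite subr_ge0 expr_le1 ?divr_ge0 ?(ltW ds) ?(ltW delta_gt0)//.
by rewrite ler_pdivrMr; lra.
Qed.

Lemma dsoftplus_le1 s : dsoftplus s <= 1.
Proof. by rewrite /dsoftplus; case: (lerP s 0) => // s0; rewrite gerBl sqr_ge0. Qed.

Lemma softplus_ge0 s : 0 <= softplus s.
Proof.
have d0 := delta_gt0.
rewrite /softplus; case: (lerP s 0) => // s0.
by rewrite divr_ge0 ?sqr_ge0//; lra.
Qed.

Lemma softplus_le s t : 0 <= t -> s <= t -> softplus s <= t.
Proof.
have d0 := delta_gt0.
rewrite /softplus; case: (lerP s 0) => // s0 t0 st.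
by rewrite ler_pdivrMr; nra.
Qed.

Lemma softplus_geB s : s - delta <= softplus s.
Proof.
have d0 := delta_gt0.
rewrite /softplus; case: (lerP s 0) => // s0; first lra.
by rewrite ler_pdivlMr; nra.
Qed.

Lemma softplus_lower s t : softplus s + dsoftplus s * (t - s) <= softplus t.
Proof.
have d0 := delta_gt0.
rewrite /softplus /dsoftplus; case: (lerP s 0) => s0.
  by rewrite mul0r addr0 -/(softplus t) softplus_ge0.
have ds : 0 < delta + s by lra.
case: (lerP t 0) => t0.
  have -> : s ^+ 2 / (delta + s) + (1 - (delta / (delta + s)) ^+ 2) * (t - s) =
    (- (delta * s ^+ 2) + t * (s ^+ 2 + 2 * delta * s)) / (delta + s) ^+ 2.
    by field; rewrite gt_eqF.
  have s2 : 0 <= s ^+ 2 + 2 * delta * s by nra.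
  by rewrite ler_pdivrMr ?exprn_gt0// mul0r; nra.
have dt : 0 < delta + t by lra.
rewrite -subr_ge0.
have -> : t ^+ 2 / (delta + t) - (s ^+ 2 / (delta + s) + (1 - (delta / (delta + s)) ^+ 2) * (t - s))
  = delta ^+ 2 * (t - s) ^+ 2 / ((delta + s) ^+ 2 * (delta + t)).
  by field; rewrite !gt_eqF.
by rewrite divr_ge0// mulr_ge0 ?sqr_ge0// ltW.
Qed.

(* The factor 1 - dsoftplus s is what makes the smoothness constants of nested
   soft maxima average out instead of adding up. The bound fails for t far below
   0 < s. *)
Lemma softplus_upper s t : `|t - s| <= delta -> softplus t <=
  softplus s + dsoftplus s * (t - s) + 2 / delta * (1 - dsoftplus s) * (t - s) ^+ 2.
Proof.
have d0 := delta_gt0.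
rewrite ler_norml => /andP[st _].
rewrite /softplus /dsoftplus; case: (lerP s 0) => s0.
  rewrite mul0r !add0r subr0; case: (lerP t 0) => t0.
    by rewrite mulr_ge0 ?sqr_ge0// mulr_ge0// divr_ge0// ltW.
  rewrite mulr1 [leRHS]mulrAC; apply: (@le_trans _ _ (2 * t ^+ 2 / delta)).
    have t2 := sqr_ge0 t.
    by apply: ler_pM; rewrite ?invr_ge0 ?lef_pV2 ?posrE//; lra.
  by rewrite ler_wpM2r ?invr_ge0 ?(ltW d0)//; nra.
have ds : 0 < delta + s by lra.
case: (lerP t 0) => t0.
  rewrite -subr_ge0 subr0.
  have -> : s ^+ 2 / (delta + s) + (1 - (delta / (delta + s)) ^+ 2) * (t - s) +
    2 / delta * (1 - (1 - (delta / (delta + s)) ^+ 2)) * (t - s) ^+ 2 =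
    (t * s ^+ 2 + delta * t ^+ 2 + delta * (t - s) ^+ 2) / (delta + s) ^+ 2.
    by field; rewrite !gt_eqF.
  rewrite divr_ge0 ?sqr_ge0//.
  (* Locality enters here: [-delta <= t - s] gives [delta + t >= s > 0]. The numerator is the first
     of these three quantities plus twice the other two. *)
  have h1 : 0 <= (delta + t) * s ^+ 2 by rewrite mulr_ge0 ?sqr_ge0//; lra.
  have h2 : 0 <= delta * t ^+ 2 by rewrite mulr_ge0 ?sqr_ge0//; lra.
  have h3 : 0 <= delta * (- t * s) by rewrite !mulr_ge0//; lra.
  by lra.
have dt : 0 < delta + t by lra.
rewrite -subr_ge0.
have -> : s ^+ 2 / (delta + s) + (1 - (delta / (delta + s)) ^+ 2) * (t - s) +
    2 / delta * (1 - (1 - (delta / (delta + s)) ^+ 2)) * (t - s) ^+ 2 - t ^+ 2 / (delta + t)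
  = delta * (delta + 2 * t) * (t - s) ^+ 2 / ((delta + s) ^+ 2 * (delta + t)).
  by field; rewrite !gt_eqF.
by rewrite divr_ge0// mulr_ge0 ?sqr_ge0 ?(ltW dt)// mulr_ge0 ?(ltW d0)//; lra.
Qed.

End softplus.

(** * Nested smooth maxima *)

Section softmax_chain.
Context {R : realType} {m : nat}.
Variables (delta gamma : R) (v : nat -> vec R m).
Implicit Types (x y d : vec R m) (r n : nat).

Definition affine_piece r x : R := dotv (v r) x - r%:R * gamma.

(** Piece [r] is outermost and [n] counts the pieces nested inside it, so that the maximum runs over
    the pieces [r] to [r + n] and cutting the chain removes its innermost pieces. *)
Fixpoint chain n r x : R := let a := affine_piece r x in
  if n is n'.+1 then a + softplus delta (chain n' r.+1 x - a) else a.

Fixpoint chain_grad n r x : vec R m :=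
  if n is n'.+1 then
    let w := dsoftplus delta (chain n' r.+1 x - affine_piece r x) in
    (1 - w) *: v r + w *: chain_grad n' r.+1 x
  else v r.

Hypothesis delta_gt0 : 0 < delta.

Lemma affine_pieceB r x y : affine_piece r y - affine_piece r x = dotv (v r) (y - x).
Proof. by rewrite /affine_piece dotvBr; ring. Qed.

(** Convexity of [softplus] handles the outer layer. The inner subgradient inequality survives
    multiplication by the weight [w], which is nonnegative. *)
Lemma chain_lower n r x y :
  chain n r x + dotv (chain_grad n r x) (y - x) <= chain n r y.
Proof.
elim: n r => [|n IH] r /=; first by have := affine_pieceB r x y; lra.
have hb := affine_pieceB r x y.
set ax := affine_piece r x in hb *; set ay := affine_piece r y in hb *.
set w := dsoftplus _ _.
have hs := softplus_lower delta_gt0 (chain n r.+1 x - ax) (chain n r.+1 y - ay).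
have w0 : 0 <= w by exact: dsoftplus_ge0.
have := ler_wpM2l w0 (IH r.+1).
rewrite dotvDl !dotvZl -hb; move: hs; rewrite -/w; lra.
Qed.

Hypothesis v_le1 : forall r, enorm (v r) <= 1.

Let dotv_v_le r d : dotv (v r) d <= enorm d.
Proof.
apply: le_trans (dotv_le_enorm _ _) _.
by rewrite -[leRHS]mul1r ler_wpM2r ?enorm_ge0.
Qed.

(** The gradient is a convex combination of the vectors [v s]; stated against a fixed direction, the
    bound passes linearly through the induction. *)
Lemma dotv_chain_grad_le n r x d : dotv (chain_grad n r x) d <= enorm d.
Proof.
elim: n r => [|n IH] r //=; set w := dsoftplus _ _.
have w0 : 0 <= w by exact: dsoftplus_ge0.
have w1 : w <= 1 by exact: dsoftplus_le1.
have := ler_wpM2l w0 (IH r.+1).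
have w1' : 0 <= 1 - w by lra.
have := ler_wpM2l w1' (dotv_v_le r d).
rewrite dotvDl !dotvZl; lra.
Qed.

Lemma chain_grad_le1 n r x : enorm (chain_grad n r x) <= 1.
Proof. by apply: enorm_le1_dual => d; exact: dotv_chain_grad_le. Qed.

Lemma chain_lipschitz n r x y : `|chain n r x - chain n r y| <= enorm (x - y).
Proof.
have h1 := chain_lower n r x y; have h2 := chain_lower n r y x.
have h3 := dotv_chain_grad_le n r x (x - y).
have h4 := dotv_chain_grad_le n r y (y - x).
have h5 : dotv (chain_grad n r x) (y - x) = - dotv (chain_grad n r x) (x - y).
  by rewrite -dotvNr opprB.
have h6 : dotv (chain_grad n r y) (y - x) = - dotv (chain_grad n r y) (x - y).
  by rewrite -dotvNr opprB.
move: h4; rewrite (enormB y x) => h4; rewrite ler_norml; apply/andP; split; lra.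
Qed.

(** The constant does not depend on [n]: the outer layer costs [1 - w] times
    [8 / delta * enorm (y - x) ^+ 2], the inner chain costs [w] times the same quantity, and the
    weights add up to 1. The radius is [delta / 2] because the argument of [softplus] moves by up to
    [2 * enorm (y - x)]. *)
Lemma chain_upper n r x y : enorm (y - x) <= delta / 2 ->
  chain n r y <= chain n r x + dotv (chain_grad n r x) (y - x)
                 + 16 / delta / 2 * enorm (y - x) ^+ 2.
Proof.
move=> hxy; have K0 : 0 <= 16 / delta / 2 * enorm (y - x) ^+ 2.
  by rewrite mulr_ge0 ?sqr_ge0// !divr_ge0// ltW.
elim: n r => [|n IH] r /=; first by have := affine_pieceB r x y; lra.
have hb := affine_pieceB r x y.
have hc := chain_lipschitz n r.+1 y x.
have ha := norm_dotv_le (v r) (y - x).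
have {}ha : `|dotv (v r) (y - x)| <= enorm (y - x).
  by apply: le_trans ha _; rewrite -[leRHS]mul1r ler_wpM2r ?enorm_ge0.
have e0 := enorm_ge0 (y - x); have d0 := delta_gt0.
set ax := affine_piece r x in hb *; set ay := affine_piece r y in hb *.
set cx := chain n r.+1 x in hc *; set cy := chain n r.+1 y in hc *.
have hst : `|cy - ay - (cx - ax)| <= 2 * enorm (y - x).
  have -> : cy - ay - (cx - ax) = (cy - cx) - (ay - ax) by ring.
  by rewrite (le_trans (ler_normB _ _))// hb; lra.
have hd : `|cy - ay - (cx - ax)| <= delta by lra.
have := softplus_upper delta_gt0 hd.
set w := dsoftplus _ _.
have w0 : 0 <= w by exact: dsoftplus_ge0.
have w1 : w <= 1 by exact: dsoftplus_le1.
have hsq : (cy - ay - (cx - ax)) ^+ 2 <= 4 * enorm (y - x) ^+ 2.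
  rewrite -real_normK ?num_real//; have := normr_ge0 (cy - ay - (cx - ax)); nra.
have w2 : 0 <= 2 / delta * (1 - w).
  by rewrite mulr_ge0 ?divr_ge0 ?(ltW delta_gt0)//; lra.
have h1 := ler_wpM2l w2 hsq.
have h2 := ler_wpM2l w0 (IH r.+1).
have -> : 2 / delta * (1 - w) = (1 - w) * (2 / delta) by rewrite mulrC.
rewrite dotvDl !dotvZl -hb.
have e1 : 2 / delta * (1 - w) * (4 * enorm (y - x) ^+ 2) = (1 - w) * (16 / delta / 2 * enorm (y - x) ^+ 2).
  by field; rewrite gt_eqF.
move: h1 h2; rewrite e1 -/cx -/cy; set Q := 16 / delta / 2 * _; lra.
Qed.

(** The right side equals 8, while two gradients of norm at most 1 differ by at most 2. This
    supplies the step-length hypothesis behind co-coercivity. *)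
Lemma chain_step n r x y : enorm (chain_grad n r x - chain_grad n r y) <= 16 / delta * (delta / 2).
Proof.
apply: le_trans (enormD _ _) _; rewrite enormN.
have -> : 16 / delta * (delta / 2) = 8 :> R by field; rewrite gt_eqF.
by have := chain_grad_le1 n r x; have := chain_grad_le1 n r y; lra.
Qed.

Let K_gt0 : 0 < 16 / delta. Proof. by rewrite divr_gt0. Qed.
Let rho_gt0 : 0 < delta / 2. Proof. by rewrite divr_gt0. Qed.

Lemma chain_is_gradient n r x : is_gradient (chain n r) x (chain_grad n r x).
Proof. exact: (smooth_is_gradient (@chain_lower n r) (@chain_upper n r) K_gt0 rho_gt0). Qed.

Lemma chain_grad_lipschitz n r x y :
  enorm (chain_grad n r x - chain_grad n r y) <= 16 / delta * enorm (x - y).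
Proof.
exact: (smooth_lipschitz_gradient (@chain_lower n r) (@chain_upper n r) K_gt0
  (@chain_step n r)).
Qed.

Lemma chain_le n r x c : (forall s, (r <= s <= r + n)%N -> affine_piece s x <= c) ->
  chain n r x <= c.
Proof.
elim: n r => [|n IH] r h /=; first by apply: h; rewrite addn0 leqnn.
have ha : affine_piece r x <= c by apply: h; rewrite leqnn leq_addr.
have hc : chain n r.+1 x <= c.
  by apply: IH => s /andP[h1 h2]; apply: h; rewrite (ltnW h1) -addSnnS.
by rewrite -lerBrDl softplus_le//; lra.
Qed.

Lemma chain_ge_head n r x : affine_piece r x <= chain n r x.
Proof. by case: n => [|n] //=; rewrite lerDl softplus_ge0. Qed.

Lemma chain_ge n r x : affine_piece (r + n) x - n%:R * delta <= chain n r x.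
Proof.
elim: n r => [|n IH] r /=; first by rewrite addn0 mul0r subr0.
have := softplus_geB delta_gt0 (chain n r.+1 x - affine_piece r x).
have := IH r.+1; rewrite addSnnS -natr1; lra.
Qed.

(** At the innermost kept piece, the rest of the chain lies below that piece by [chain_le], so
    [softplus] and its derivative both vanish there; the outer layers see no change in value or
    gradient. *)
Lemma chain_truncate n j r x :
  (forall s, (r + n < s <= r + n + j)%N -> affine_piece s x <= affine_piece (r + n) x) ->
  chain (n + j) r x = chain n r x /\ chain_grad (n + j) r x = chain_grad n r x.
Proof.
elim: n r => [|n IH] r; last first.
  rewrite addSn -addSnnS => h.
  by have [/= -> ->] := IH r.+1 h.
rewrite add0n addn0; case: j => [//|j] h /=.
have hc : chain j r.+1 x - affine_piece r x <= 0.
  by rewrite subr_le0; apply: chain_le => s hs; apply: h; rewrite -addSnnS.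
rewrite /softplus /dsoftplus hc addr0; split=> //.
by rewrite subr0 scale1r scale0r addr0.
Qed.

End softmax_chain.

Lemma chain_local {R : realType} {m} (delta gamma : R) (v v' : nat -> vec R m) n r :
  (forall s, (s <= r + n)%N -> v s = v' s) ->
  chain delta gamma v n r = chain delta gamma v' n r /\
  chain_grad delta gamma v n r = chain_grad delta gamma v' n r.
Proof.
elim: n r => [|n IH] r h.
  by split; apply/funext => x /=; rewrite /affine_piece h// addn0.
have [h1 h2] := IH r.+1 (fun s hs => h s (eq_rect _ (fun k => (s <= k)%N) hs _ (addSnnS r n))).
by split; apply/funext => x /=; rewrite /affine_piece h ?leq_addr// h1 ?h2.
Qed.

(** * Measurability *)

Section measurability.
Context {R : realType} {m : nat}.

Lemma measurable_vec_coord (i : 'I_m) : measurable_fun setT (fun x : vec R m => x ord0 i).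
Proof.
move=> _ Y mY; rewrite setTI; apply: sub_sigma_algebra => /=.
rewrite -bigcup_seq/=; exists i => /=; first by rewrite mem_index_enum.
by exists Y => //; rewrite setTI.
Qed.

(** The sigma-algebra on [vec R m] is generated by the coordinates, and preimages commute with
    generation. *)
Lemma measurable_fun_vecP d (T : measurableType d) (h : T -> vec R m) :
  measurable_fun setT h <-> (forall i, measurable_fun setT (fun x => h x ord0 i)).
Proof.
split=> [mh i|mh].
  exact: (measurableT_comp (measurable_vec_coord i) mh).
have : g_sigma_preimage (fun i => (@vec_coord R m i) \o h) `<=` measurable.
  apply: smallest_sub; first exact: sigma_algebra_measurable.
  rewrite -bigcup_seq/=; apply: bigcup_sub => i _.
  by move=> A [Y mY <-]; exact: mh.
rewrite g_sigma_preimage_comp => sub _ A mA.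
by apply: sub; exists A.
Qed.

Context {d : measure_display} {T : measurableType d}.
Implicit Types x y : T -> vec R m.

Lemma measurable_dotv x y : measurable_fun setT x -> measurable_fun setT y ->
  measurable_fun setT (fun t => dotv (x t) (y t)).
Proof.
move=> /measurable_fun_vecP mx /measurable_fun_vecP my.
by apply: measurable_sum => i; exact: measurable_funM.
Qed.

Lemma measurable_scalev (a : T -> R) x : measurable_fun setT a -> measurable_fun setT x ->
  measurable_fun setT (fun t => a t *: x t : vec R m).
Proof.
move=> ma /measurable_fun_vecP mx; apply/measurable_fun_vecP => i.
under eq_fun do rewrite mxE.
exact: measurable_funM.
Qed.

Lemma measurable_addv x y : measurable_fun setT x -> measurable_fun setT y ->
  measurable_fun setT (fun t => x t + y t : vec R m).
Proof.
move=> /measurable_fun_vecP mx /measurable_fun_vecP my; apply/measurable_fun_vecP => i.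
under eq_fun do rewrite mxE.
exact: measurable_funD.
Qed.

End measurability.

Section softplus_measurable.
Context {R : realType} (delta : R).
Hypothesis delta_gt0 : 0 < delta.

Lemma measurable_softplus : measurable_fun setT (softplus delta).
Proof.
apply: nondecreasing_measurable => // s t st.
have := softplus_lower delta_gt0 s t; have := dsoftplus_ge0 delta_gt0 s; nra.
Qed.

(** Monotone functions are measurable; monotonicity of the derivative follows by adding the tangent
    inequalities at [s] and at [t]. *)
Lemma measurable_dsoftplus : measurable_fun setT (dsoftplus delta).
Proof.
apply: nondecreasing_measurable => // s t.
rewrite le_eqVlt => /predU1P[->//|st].
have := softplus_lower delta_gt0 s t; have := softplus_lower delta_gt0 t s; nra.
Qed.

Context {m : nat} (gamma : R) (v : nat -> vec R m).

Let measurable_affine_piece r : measurable_fun setT (affine_piece gamma v r).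
Proof.
by apply: measurable_funB => //; exact: measurable_dotv.
Qed.

Lemma measurable_chain n r : measurable_fun setT (chain delta gamma v n r).
Proof.
elim: n r => [|n IH] r //=; apply: measurable_funD => //.
apply: (measurableT_comp measurable_softplus).
exact: measurable_funB.
Qed.

Lemma measurable_chain_grad n r : measurable_fun setT (chain_grad delta gamma v n r).
Proof.
elim: n r => [|n IH] r //=.
have mw : measurable_fun setT
    (fun x => dsoftplus delta (chain delta gamma v n r.+1 x - affine_piece gamma v r x)).
  apply: (measurableT_comp measurable_dsoftplus).
  by apply: measurable_funB => //; exact: measurable_chain.
apply: measurable_addv; apply: measurable_scalev => //.
exact: measurable_funB.
Qed.

End softplus_measurable.

(** * Runs, levels and expectations *)

Section oracle_run.
Context {R : realType} {N m : nat} {dX : measure_display} {Xi : measurableType dX}.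
Variables (Rule : 'I_N -> hist R N m -> Xi -> vec R m) (Xhat : hist R N m -> Xi -> vec R m).
Implicit Types (O : 'I_N -> vec R m -> R * vec R m) (q : 'I_N -> vec R m) (xi : Xi) (i : nat).

(** The oracle may differ from node to node. This covers both fresh samples at each node and the
    replacement of the true oracle by one truncated according to the level of the node. *)
Definition ohist O q : hist R N m := [tuple (q s, O s (q s)) | s < N].
Definition orun O xi i := iter i (fun q t => Rule t (ohist O q) xi) (fun _ => 0).
Definition ooutput O xi := Xhat (ohist O (orun O xi N)) xi.

Lemma outputE {dZ} {Z : measurableType dZ} (f : vec R m -> Z -> R) (g : vec R m -> Z -> vec R m)
    xi (zs : 'I_N -> Z) :
  output Rule Xhat f g xi zs = ooutput (fun s x => (f x (zs s), g x (zs s))) xi.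
Proof. by []. Qed.

Lemma eq_ohist O O' q : (forall s, O s (q s) = O' s (q s)) -> ohist O q = ohist O' q.
Proof. by move=> h; apply: eq_from_tnth => s; rewrite !tnth_mktuple h. Qed.

Lemma eq_orun O O' xi n :
  (forall i s, (i < n)%N -> O s (orun O xi i s) = O' s (orun O xi i s)) ->
  forall i, (i <= n)%N -> orun O xi i = orun O' xi i.
Proof.
move=> h; elim=> [//|i IH] iN /=; rewrite -IH 1?ltnW//.
by apply/funext => t; congr Rule; apply: eq_ohist => s; exact: h.
Qed.

(** Agreement is asked only along the run of [O], as truncation is valid only at nearly orthogonal
    queries. Round [N] is included because the output rule reads the responses to the queries of
    that round. *)
Lemma eq_ooutput O O' xi :
  (forall i s, (i <= N)%N -> O s (orun O xi i s) = O' s (orun O xi i s)) ->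
  ooutput O xi = ooutput O' xi.
Proof.
move=> h; rewrite /ooutput -(@eq_orun O O' xi N)//; last by move=> i s /ltnW; exact: h.
by congr Xhat; apply: eq_ohist => s; exact: h.
Qed.

Lemma orun_bounded B O xi i t : 0 <= B -> (forall t h xi, enorm (Rule t h xi) <= B) ->
  enorm (orun O xi i t) <= B.
Proof. by move=> B0 RB; case: i => [|i] /=; rewrite ?enorm0 ?RB. Qed.

(** Causality: a node of level at most [d] reads only ancestors, whose levels are below [d];
    induction on the round. *)
Lemma eq_orun_level (G : rel 'I_N) (lev : 'I_N -> nat) O O' xi d :
  (forall t h h' xi, (forall s, ancestor G s t -> tnth h s = tnth h' s) ->
     Rule t h xi = Rule t h' xi) ->
  (forall s t, ancestor G s t -> (lev s < lev t)%N) ->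
  (forall s, (lev s < d)%N -> O s = O' s) ->
  forall i t, (lev t <= d)%N -> orun O xi i t = orun O' xi i t.
Proof.
move=> hR hlev hO; elim=> [//|i IH] t td /=.
apply: hR => s /hlev st; rewrite !tnth_mktuple.
have sd := leq_trans st td.
by rewrite IH ?(ltnW sd)// hO.
Qed.

Hypothesis measurable_Rule : forall t, measurable_fun setT
  (fun p : hist R N m * Xi => Rule t p.1 p.2).
Hypothesis measurable_Xhat : measurable_fun setT (fun p : hist R N m * Xi => Xhat p.1 p.2).

Let measurable_ohist O (q : Xi -> 'I_N -> vec R m) :
  (forall s, measurable_fun setT (O s)) ->
  (forall s, measurable_fun setT (fun xi => q xi s)) ->
  measurable_fun setT (fun xi => ohist O (q xi)).
Proof.
move=> mO mq; apply/measurable_fun_tnthP => s /=.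
rewrite (_ : _ \o _ = fun xi => (q xi s, O s (q xi s))); last first.
  by apply/funext => xi /=; rewrite tnth_mktuple.
apply: measurable_fun_pair => //.
exact: (measurableT_comp (mO s) (mq s)).
Qed.

Lemma measurable_orun O : (forall s, measurable_fun setT (O s)) ->
  forall i t, measurable_fun setT (fun xi => orun O xi i t).
Proof.
move=> mO; elim=> [|i IH] t /=; first exact: measurable_cst.
apply: (measurableT_comp (measurable_Rule t)
  (g := fun xi => (ohist O (orun O xi i), xi))).
by apply: measurable_fun_pair => //; exact: measurable_ohist.
Qed.

Lemma measurable_ooutput O : (forall s, measurable_fun setT (O s)) ->
  measurable_fun setT (ooutput O).
Proof.
move=> mO; apply: (measurableT_comp measurable_Xhat
  (g := fun xi => (ohist O (orun O xi N), xi))).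
by apply: measurable_fun_pair => //; apply: measurable_ohist => // s; exact: measurable_orun.
Qed.

End oracle_run.

(** The level is the largest number of edges on a path ending at the node, bounded through the
    depth. A longest path to an ancestor extends to a strictly longer path to the descendant. *)
Lemma exists_level N (G : rel 'I_N) D : has_depth G D ->
  exists lev : 'I_N -> nat,
    (forall s t, ancestor G s t -> (lev s < lev t)%N) /\ (forall t, (lev t < D)%N).
Proof.
move=> [_ hD]; pose ends n t := `[< exists x p, [/\ path G x p, last x p = t & size p = n] >].
have ends_lt n t : ends n t -> (n < D)%N.
  by move=> /asboolP[x [p [Gp _ <-]]]; exact: hD Gp.
have ends0 t : exists n, ends n t by exists 0%N; apply/asboolP; exists t, [::].
have endsD t n : ends n t -> (n <= D)%N by move=> /ends_lt/ltnW.
exists (fun t => ex_maxn (ends0 t) (endsD t)); split=> [s t|t]; last first.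
  by case: ex_maxnP => n /ends_lt.
case: ex_maxnP => k /asboolP[x [p [Gp ps <-]]] _ /existsP[u /andP[Gsu /connectP[p' Gp' tE]]].
case: ex_maxnP => n _ /(_ (size (p ++ u :: p'))) h.
have : (size (p ++ u :: p') <= n)%N.
  apply: h; apply/asboolP; exists x, (p ++ u :: p'); split=> //.
    by rewrite cat_path Gp /= ps Gsu.
  by rewrite last_cat /= tE.
by apply: leq_trans; rewrite size_cat /= addnS ltnS leq_addr.
Qed.

(** * Uniform samples, finite averages and the averaging argument *)

Section uniform_nat.
Context {R : realType}.
Variable n : nat.

Let w : {nonneg R} := ((n.+1)%:R^-1 : R)%:nng.

(** The uniform law on [0, ..., n], carried by [nat] so that both hard instances use the same sample
    space; [n = 0] makes the problem deterministic. *)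
Definition uniform_nat : set nat -> \bar R := mscale w (msum (fun i => \d_i) n.+1).

HB.instance Definition _ := Measure.on uniform_nat.

Lemma uniform_nat_setT : uniform_nat setT = 1%E.
Proof.
have -> : uniform_nat setT = ((n.+1%:R^-1)%:E * \sum_(i < n.+1) (\d_(i : nat) setT : \bar R))%E by [].
under eq_bigr do rewrite diracT.
rewrite sumEFin -EFinM sumr_const card_ord.
by rewrite mulVf ?pnatr_eq0.
Qed.

HB.instance Definition _ := Measure_isProbability.Build _ _ _ uniform_nat uniform_nat_setT.

Lemma integral_uniform_nat (f : nat -> R) :
  (\int[uniform_nat]_i (f i)%:E = ((\sum_(i < n.+1) f i) / n.+1%:R)%:E)%E.
Proof.
have ge0 (h : nat -> R) : (forall i, 0 <= h i) ->
    (\int[uniform_nat]_i (h i)%:E = ((\sum_(i < n.+1) h i) / n.+1%:R)%:E)%E.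
  move=> h0; rewrite ge0_integral_mscale//; last by move=> i _; rewrite lee_fin.
  rewrite ge0_integral_measure_sum//; last by move=> i _; rewrite lee_fin.
  under eq_bigr do rewrite integral_dirac// diracT mul1e.
  by rewrite sumEFin -EFinM mulrC.
(* The nonnegative case [ge0] is applied to the positive and negative parts. *)
rewrite integralE; under eq_integral do rewrite funeposE -EFin_max.
under [X in (_ - X)%E]eq_integral do rewrite funenegE -EFinN -EFin_max.
rewrite !ge0 -?EFinB; last 2 first.
- by move=> i; rewrite le_max lexx orbT.
- by move=> i; rewrite le_max lexx orbT.
rewrite -mulrBl -sumrB; congr ((_ / _)%:E); apply: eq_bigr => i _.
by rewrite /Num.max; case: (ltrP (f i) 0); case: (ltrP (- f i) 0); lra.
Qed.

End uniform_nat.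

Section finite_expectation.
Context {R : realType}.
Variable n : nat.
Implicit Types (k : nat) (G : seq nat -> R).

(** Real-valued form of [iid_expect] under the uniform law; as an iterated finite average it
    commutes with sums over a finite family of instances. *)
Fixpoint mean_seq k G : R :=
  if k is k'.+1 then (\sum_(i < n.+1) mean_seq k' (fun s => G ((i : nat) :: s))) / n.+1%:R
  else G [::].

Lemma iid_expect_uniform k G :
  iid_expect (uniform_nat n) k (fun s => (G s)%:E) = (mean_seq k G)%:E.
Proof.
elim: k G => [//|k IH] G /=.
under eq_integral do rewrite (IH (fun s => G (_ :: s))).
exact: integral_uniform_nat.
Qed.

Lemma mean_seq_ge k G c : (forall s, c <= G s) -> c <= mean_seq k G.
Proof.
elim: k G => [|k IH] G h /=; first exact: h.
rewrite ler_pdivlMr ?ltr0n// -[X in _ * X%:R]card_ord mulr_natr -sumr_const.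
by apply: ler_sum => i _; apply: IH.
Qed.

Lemma mean_seqN k G : mean_seq k (fun s => - G s) = - mean_seq k G.
Proof.
elim: k G => [//|k IH] G /=.
by under eq_bigr do rewrite IH; rewrite sumrN mulNr.
Qed.

Lemma norm_mean_seq_le k G c : (forall s, `|G s| <= c) -> `|mean_seq k G| <= c.
Proof.
move=> h; rewrite ler_norml; apply/andP; split.
  by apply: mean_seq_ge => s; have := h s; rewrite ler_norml => /andP[].
rewrite -lerN2 -mean_seqN; apply: mean_seq_ge => s.
by have := h s; rewrite ler_norml lerN2 => /andP[].
Qed.

Lemma mean_seq_sum (S : finType) k (G : S -> seq nat -> R) :
  mean_seq k (fun s => \sum_x G x s) = \sum_x mean_seq k (G x).
Proof.
elim: k G => [//|k IH] G /=.
under eq_bigr do rewrite IH.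
by rewrite exchange_big/= mulr_suml.
Qed.

Lemma measurable_mean_seq d (T : measurableType d) k (G : seq nat -> T -> R) :
  (forall s, measurable_fun setT (G s)) ->
  measurable_fun setT (fun t => mean_seq k (G^~ t)).
Proof.
elim: k G => [|k IH] G h /=; first exact: h.
apply: measurable_funM => //; apply: measurable_sum => i.
by apply: (IH (fun s => G ((i : nat) :: s))).
Qed.

End finite_expectation.

(** The probabilistic method: were all integrals below [a], their sum would be strictly below
    [a * #|S|] ([S] is nonempty), against the integrated pointwise bound. *)
Lemma exists_ge_mean {R : realType} d (T : measurableType d) (mu : probability T R)
    (S : finType) (F : S -> T -> R) (a c : R) : (0 < #|S|)%N ->
  (forall x, measurable_fun setT (F x)) -> (forall x t, `|F x t| <= c) ->
  (forall t, a * #|S|%:R <= \sum_x F x t) ->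
  exists x, (a%:E <= \int[mu]_t (F x t)%:E)%E.
Proof.
move=> S0 mF Fc Fa.
have muT : mu setT = 1%E by exact: probability_setT.
have iF x : mu.-integrable setT (EFin \o F x).
  apply: measurable_bounded_integrable => //; first by rewrite (@le_lt_trans _ _ 1%E) ?probability_le1 ?ltry.
  exists c; split; rewrite ?num_real// => K cK t _.
  exact: le_trans (Fc x t) (ltW cK).
apply/not_existsP => h.
have lt_a x : (\int[mu]_t (F x t)%:E < a%:E)%E by rewrite ltNge; apply/negP; exact: h.
have : (\int[mu]_t (\sum_x F x t)%:E < (a * #|S|%:R)%:E)%E.
  under eq_integral do rewrite -sumEFin.
  rewrite integral_sum//.
  have -> : a * #|S|%:R = \sum_(x : S) a by rewrite sumr_const mulr_natr.
  have [x0 _] : exists x0 : S, x0 \in S by apply/card_gt0P.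
  have fint x : (\int[mu]_t (F x t)%:E)%E = (fine (\int[mu]_t (F x t)%:E)%E)%:E.
    by rewrite fineK//; apply: (integrable_fin_num measurableT); exact: iF.
  under eq_bigr do rewrite fint.
  rewrite !sumEFin lte_fin; apply: ltr_sum => [|x _]; last by rewrite -lte_fin -fint.
  by apply/hasP; exists x0; rewrite ?mem_index_enum.
apply/negP; rewrite -leNgt.
have <- : (\int[mu]_t (a * #|S|%:R)%:E = (a * #|S|%:R)%:E)%E.
  by rewrite integral_cst// -[RHS]mule1; congr (_ * _)%E; exact: muT.
apply: le_integral => //.
- apply: measurable_bounded_integrable => //; first by rewrite (@le_lt_trans _ _ 1%E) ?probability_le1 ?ltry.
  by exists `|a * #|S|%:R|; split; rewrite ?num_real// => K cK t _; rewrite ltW.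
- under [X in integrable _ _ X]eq_fun do rewrite -sumEFin.
  apply: (integrable_sum measurableT) => x _; exact: iF.
- by move=> t _; rewrite lee_fin.
Qed.

Lemma bounded_integrable_nat {R : realType} (P : probability nat R) (f : nat -> R) c :
  (forall i, `|f i| <= c) -> P.-integrable setT (fun i => (f i)%:E).
Proof.
move=> fc; apply: measurable_bounded_integrable => //.
  by rewrite (@le_lt_trans _ _ 1%E) ?probability_le1 ?ltry.
exists c; split; rewrite ?num_real// => K cK t _.
exact: le_trans (fc t) (ltW cK).
Qed.

(** Reduction to a random instance: with seed and samples fixed, the loss averaged over [S] is at
    least [a], while each instance has a point of value at most [b]. Averaging over samples and seed
    then singles out one instance with gap [a - b]. *)
Lemma exists_hard_instance {R : realType} N m n {dX} {Xi : measurableType dX}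
    (mu : probability Xi R) (Rule : 'I_N -> hist R N m -> Xi -> vec R m)
    (Xhat : hist R N m -> Xi -> vec R m) (B a b c : R) (S : finType)
    (f : S -> vec R m -> nat -> R) (g : S -> vec R m -> nat -> vec R m) :
  (0 < #|S|)%N ->
  (forall h xi, enorm (Xhat h xi) <= B) ->
  (forall t, measurable_fun setT (fun p : hist R N m * Xi => Rule t p.1 p.2)) ->
  measurable_fun setT (fun p : hist R N m * Xi => Xhat p.1 p.2) ->
  (forall x, measurable_fun setT (fun p : vec R m * nat => (f x p.1 p.2, g x p.1 p.2))) ->
  (forall x y i, enorm y <= B -> `|f x y i| <= c) ->
  (forall xi (zs : 'I_N -> nat), a * #|S|%:R <=
     \sum_x (\sum_(i < n.+1) f x (output Rule Xhat (f x) (g x) xi zs) i) / n.+1%:R) ->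
  (forall x, exists2 y, enorm y <= B & (\sum_(i < n.+1) f x y i) / n.+1%:R <= b) ->
  exists x, ((a - b)%:E <= expected_loss Rule Xhat (f x) (g x) mu (uniform_nat n)
                           - opt_value (f x) B (uniform_nat n))%E.
Proof.
move=> S0 hX mRule mXhat mfg fc fa fb.
pose loss x xi (zs : seq nat) : R := (\sum_(i < n.+1)
  f x (output Rule Xhat (f x) (g x) xi (fun s => nth point zs s)) i) / n.+1%:R.
have lossc x xi zs : `|loss x xi zs| <= c.
  rewrite normrM normfV normr_nat ler_pdivrMr ?ltr0n//.
  rewrite -[X in _ * X%:R]card_ord mulr_natr -sumr_const.
  by apply: le_trans (ler_norm_sum _ _ _) _; apply: ler_sum => i _; exact/fc/hX.
have mf x i : measurable_fun setT (fun y => f x y i).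
  have mp : measurable_fun setT (fun y : vec R m => (y, i)).
    by apply: measurable_fun_pair.
  exact: (measurableT_comp measurable_fst (measurableT_comp (mfg x) mp)).
have mg x i : measurable_fun setT (fun y => (f x y i, g x y i)).
  have mp : measurable_fun setT (fun y : vec R m => (y, i)).
    by apply: measurable_fun_pair.
  exact: (measurableT_comp (mfg x) mp).
have mloss x zs : measurable_fun setT (fun xi => loss x xi zs).
  apply: measurable_funM => //; apply: measurable_sum => i.
  apply: (measurableT_comp (mf x i)).
  exact: (measurable_ooutput mRule mXhat (fun s => mg x _)).
have [x ax] : exists x, (a%:E <= \int[mu]_xi (mean_seq n N (loss x xi))%:E)%E.
  apply: (@exists_ge_mean _ _ _ mu S (fun x xi => mean_seq n N (loss x xi)) a c) => //.
  - by move=> x; exact: (measurable_mean_seq n N (G := fun zs xi => loss x xi zs)).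
  - by move=> x xi; exact: norm_mean_seq_le.
  - move=> xi; rewrite -mean_seq_sum; apply: mean_seq_ge => zs; exact: fa.
exists x; rewrite EFinB; apply: leeB.
  rewrite /expected_loss; apply: le_trans ax _.
  rewrite le_eqVlt; apply/orP; left; apply/eqP; apply: eq_integral => xi _.
  rewrite -iid_expect_uniform; congr iid_expect.
  by apply/funext => zs; rewrite integral_uniform_nat.
have [y yB yb] := fb x.
apply: le_trans (_ : ((\sum_(i < n.+1) f x y i) / n.+1%:R)%:E <= _)%E; last by rewrite lee_fin.
by apply: ereal_inf_lbound; exists y => //; rewrite integral_uniform_nat.
Qed.

(** * The statistical term *)

Section signs.
Context {R : realType} {I : finType}.
Implicit Types (s : {ffun I -> bool}) (i : I).

Definition sgnb (b : bool) : R := (-1) ^+ b.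

Lemma sgnb_sqr b : sgnb b ^+ 2 = 1.
Proof. by rewrite /sgnb sqrr_sign. Qed.

Lemma sgnb_addb b c : sgnb (b (+) c) = sgnb b * sgnb c.
Proof. by rewrite /sgnb signr_addb. Qed.

Definition flip (a s : {ffun I -> bool}) : {ffun I -> bool} := [ffun i => s i (+) a i].

Lemma flipK a : involutive (flip a).
Proof. by move=> s; apply/ffunP => i; rewrite !ffunE -addbA addbb addbF. Qed.

Lemma sum_flip a (F : {ffun I -> bool} -> R) : \sum_s F s = \sum_s F (flip a s).
Proof. by rewrite (reindex_inj (inv_inj (flipK a))). Qed.

Lemma sum_flip_opp a (F : {ffun I -> bool} -> R) :
  (forall s, F (flip a s) = - F s) -> \sum_s F s = 0.
Proof.
move=> h; have : \sum_s F s = - \sum_s F s.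
  by rewrite {1}(sum_flip a) (eq_bigr _ (fun s _ => h s)) sumrN.
by lra.
Qed.

End signs.

Section statistical_bound.
Context {R : realType} (L B : R) (N : nat).
Hypotheses (L_gt0 : 0 < L) (B_gt0 : 0 < B) (N_gt0 : (0 < N)%N).

Let n := (4 * N)%N.
Let m := n.+1.

(** [inord] sends samples out of range to coordinate 0, so that every [z : nat], in the support or
    not, gives a linear function of slope [L] up to sign. *)
Definition coin_fun (s : {ffun 'I_n.+1 -> bool}) (x : vec R n.+1) (z : nat) : R :=
  L * sgnb (s (inord z)) * x ord0 (inord z).
Definition coin_grad (s : {ffun 'I_n.+1 -> bool}) (x : vec R n.+1) (z : nat) : vec R n.+1 :=
  (L * sgnb (s (inord z))) *: delta_mx 0 (inord z).

Lemma dotv_delta k (i : 'I_k) (x : vec R k) : dotv (delta_mx 0 i) x = x ord0 i.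
Proof.
rewrite /dotv (bigD1 i)//= mxE !eqxx mul1r big1 ?addr0// => j ji.
by rewrite mxE (negbTE ji) andbF mul0r.
Qed.

Lemma coord_le_enorm k (i : 'I_k) (x : vec R k) : `|x ord0 i| <= enorm x.
Proof.
rewrite -(dotv_delta i); apply: le_trans (norm_dotv_le _ _) _.
rewrite -[leRHS]mul1r ler_wpM2r ?enorm_ge0//.
rewrite -ler_sqr ?nnegrE ?enorm_ge0// enorm_sqr dotv_delta mxE !eqxx expr1n//.
Qed.

Lemma coin_in_class (H : \bar R) s : (0 <= H)%E -> in_class L B H (coin_fun s) (coin_grad s).
Proof.
move=> H0 z; set c := L * sgnb (s (inord z)).
have cL : `|c| = L by rewrite normrM normr_sign mulr1 gtr0_norm.
have lin x y : coin_fun s x z + dotv (coin_grad s x z) (y - x) = coin_fun s y z.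
  by rewrite /coin_grad dotvZl dotv_delta !mxE /coin_fun -/c; ring.
split.
- move=> x y _ _; rewrite /coin_fun -/c -mulrBr normrM cL ler_wpM2l ?(ltW L_gt0)//.
  by have := coord_le_enorm (inord z) (x - y); rewrite !mxE.
- by move=> x y t _ _ _; rewrite /coin_fun !mxE le_eqVlt; apply/orP; left; apply/eqP; ring.
- by move=> x y _ _; rewrite lin.
- move=> h Hh; move: H0; rewrite Hh lee_fin => h0; split.
    move=> x _ e e0; exists 1 => // y _.
    have -> : coin_fun s y z - coin_fun s x z - dotv (coin_grad s x z) (y - x) = 0.
      by rewrite -(lin x y); ring.
    by rewrite normr0 mulr_ge0 ?enorm_ge0// ltW.
  by move=> x y _ _; rewrite /coin_grad subrr enorm0 mulr_ge0 ?enorm_ge0.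
Qed.

Lemma measurable_coin s : measurable_fun setT
  (fun p : vec R n.+1 * nat => (coin_fun s p.1 p.2, coin_grad s p.1 p.2)).
Proof.
have mI (h : nat -> R) : measurable_fun setT (fun p : vec R n.+1 * nat => h p.2).
  by apply: (measurableT_comp (f := h)).
apply: measurable_fun_pair; last first.
  apply/measurable_fun_vecP => i.
  exact: (mI (fun z => coin_grad s 0 z ord0 i)).
apply: measurable_funM; first exact: (mI (fun z => L * sgnb (s (inord z)))).
(* The sampled coordinate is written as a finite sum of indicators times fixed coordinates, each
   measurable. *)
rewrite (_ : (fun p => _) =
  fun p : vec R n.+1 * nat => \sum_j (inord p.2 == j)%:R * p.1 ord0 j); last first.
  apply/funext => p; rewrite (bigD1 (inord p.2))//= eqxx mul1r big1 ?addr0// => j.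
  by rewrite eq_sym => /negbTE->; rewrite mul0r.
apply: measurable_sum => j; apply: measurable_funM.
  exact: (mI (fun z => (inord z == j)%:R)).
exact: (measurableT_comp (measurable_vec_coord j)).
Qed.

Lemma statistical_lower_bound {dX} {Xi : measurableType dX}
    (mu : probability Xi R) (Rule : 'I_N -> hist R N n.+1 -> Xi -> vec R n.+1)
    (Xhat : hist R N n.+1 -> Xi -> vec R n.+1) :
  (forall h xi, enorm (Xhat h xi) <= B) ->
  (forall t, measurable_fun setT (fun p : hist R N n.+1 * Xi => Rule t p.1 p.2)) ->
  measurable_fun setT (fun p : hist R N n.+1 * Xi => Xhat p.1 p.2) ->
  exists s, ((L * B / (6 * Num.sqrt N%:R))%:E <=
    expected_loss Rule Xhat (coin_fun s) (coin_grad s) mu (uniform_nat n)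
    - opt_value (coin_fun s) B (uniform_nat n))%E.
Proof.
move=> hX mR mX.
have m0 : 0 < m%:R :> R by rewrite ltr0n.
pose a := - (L * Num.sqrt N%:R * B / m%:R); pose b := - (L * B / Num.sqrt m%:R).
have [s hs] : exists s, ((a - b)%:E <=
    expected_loss Rule Xhat (coin_fun s) (coin_grad s) mu (uniform_nat n)
    - opt_value (coin_fun s) B (uniform_nat n))%E.
  apply: (@exists_hard_instance _ _ _ _ _ _ _ _ _ B a b (L * B)) => //.
  - by apply/card_gt0P; exists [ffun=> false].
  - exact: measurable_coin.
  - move=> s y i yB; rewrite /coin_fun !normrM normr_sign mulr1 gtr0_norm//.
    by rewrite ler_wpM2l ?(ltW L_gt0)// (le_trans (coord_le_enorm _ _)).
  - move=> xi zs.
    pose X (s : {ffun 'I_n.+1 -> bool}) := output Rule Xhat (coin_fun s) (coin_grad s) xi zs.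
    pose seen i := [exists t, i == inord (zs t) :> 'I_n.+1].
    have X_local (s s' : {ffun 'I_n.+1 -> bool}) : (forall i, seen i -> s i = s' i) -> X s = X s'.
      move=> h; rewrite /X !outputE; apply: eq_ooutput => i t _.
      by rewrite /coin_fun /coin_grad h//; apply/existsP; exists t.
    (* Flipping the sign of an unseen coordinate leaves the output unchanged and negates the
       term. *)
    have unseen i : ~~ seen i -> \sum_(s : {ffun 'I_n.+1 -> bool}) sgnb (s i) * X s ord0 i = 0.
      move=> si; apply: (sum_flip_opp (a := [ffun j => j == i])) => s.
      rewrite !ffunE eqxx sgnb_addb /= (X_local _ s); last first.
        by move=> j sj; rewrite !ffunE; case: eqVneq => [jE|_]; rewrite ?addbF//; rewrite -jE sj in si.
      by rewrite /sgnb/= expr1; ring.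
    (* Cauchy-Schwarz against the negated signs on the seen coordinates; these are at most [N] in
       number, being the image of the [N] samples. *)
    have seen_le (s : {ffun 'I_n.+1 -> bool}) : - (Num.sqrt N%:R * B) <= \sum_(i | seen i) sgnb (s i) * X s ord0 i.
      pose u : vec R n.+1 := \row_i if seen i then - sgnb (s i) else 0.
      rewrite lerNl -sumrN; apply: (@le_trans _ _ (dotv u (X s))).
        rewrite /dotv [leRHS](bigID seen)/= [X in _ <= _ + X]big1 ?addr0; last first.
          by move=> i /negbTE si; rewrite mxE si mul0r.
        by apply: ler_sum => i si; rewrite mxE si mulNr.
      apply: le_trans (dotv_le_enorm _ _) _; apply: ler_pM; rewrite ?enorm_ge0//; last exact: hX.
      rewrite /enorm ler_wsqrtr//.
      have -> : \sum_i u ord0 i ^+ 2 = #|seen|%:R.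
        rewrite -sum1_card natr_sum [RHS]big_mkcond/=; apply: eq_bigr => i _.
        rewrite mxE unfold_in -/(seen i).
        by case: (seen i); rewrite ?sqrrN ?sgnb_sqr ?expr0n.
      rewrite ler_nat -[leqRHS]card_ord.
      apply: leq_trans (leq_image_card (fun t => inord (zs t) : 'I_n.+1) predT).
      apply: subset_leq_card; apply/fintype.subsetP => i /existsP[t /eqP ->].
      by apply/mapP; exists t; rewrite ?mem_enum.
    rewrite -mulr_suml ler_pdivlMr// /a.
    have -> : - (L * Num.sqrt N%:R * B / m%:R) * #|{ffun 'I_n.+1 -> bool}|%:R * m%:R =
      L * (- (Num.sqrt N%:R * B) * #|{ffun 'I_n.+1 -> bool}|%:R) by field; rewrite gt_eqF.
    have -> : \sum_x \sum_(i < n.+1) coin_fun x (X x) i =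
        L * \sum_(s : {ffun 'I_n.+1 -> bool}) \sum_(i | seen i) sgnb (s i) * X s ord0 i.
      transitivity (L * \sum_i \sum_(s : {ffun 'I_n.+1 -> bool}) sgnb (s i) * X s ord0 i).
        rewrite exchange_big/= mulr_sumr; apply: eq_bigr => i _.
        by rewrite mulr_sumr; apply: eq_bigr => s _; rewrite /coin_fun inord_val mulrA.
      congr (L * _); rewrite (bigID seen)/= [X in _ + X]big1 ?addr0; last exact: unseen.
      exact: exchange_big.
    rewrite ler_wpM2l ?(ltW L_gt0)// mulr_natr -sumr_const.
    by apply: ler_sum => s _; exact: seen_le.
  (* The comparison point has norm [B] and opposes the sign of every coordinate. *)
  - move=> s; exists (\row_i (- (B / Num.sqrt m%:R) * sgnb (s i))).
      rewrite /enorm.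
      under eq_bigr do rewrite mxE exprMn sgnb_sqr mulr1 sqrrN expr_div_n sqr_sqrtr ?(ltW m0)//.
      rewrite sumr_const card_ord -[_ *+ n.+1]mulr_natr -/m mulfVK ?gt_eqF//.
      by rewrite sqrtr_sqr gtr0_norm.
    rewrite le_eqVlt; apply/orP; left; apply/eqP.
    have -> : \sum_(i < n.+1) coin_fun s (\row_i (- (B / Num.sqrt m%:R) * sgnb (s i))) i = m%:R * b.
      transitivity (\sum_(i < n.+1) b); last by rewrite sumr_const card_ord mulr_natl.
      apply: eq_bigr => i _.
      rewrite /coin_fun mxE inord_val; transitivity (sgnb (s i) ^+ 2 * b); last by rewrite sgnb_sqr mul1r.
      by rewrite /b; ring.
    by rewrite mulrC mulKf ?gt_eqF.
exists s; apply: le_trans hs; rewrite lee_fin /a /b.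
set p := Num.sqrt N%:R; set q := Num.sqrt m%:R.
have q2 : q ^+ 2 = m%:R by rewrite sqr_sqrtr ?ltW.
have N0 : 0 < N%:R :> R by rewrite ltr0n.
have p2 : p ^+ 2 = N%:R by rewrite sqr_sqrtr ?ltW.
have p0 : 0 < p by rewrite sqrtr_gt0.
have q0 : 0 < q by rewrite sqrtr_gt0.
have hm : m%:R = 4 * N%:R + 1 :> R by rewrite /m /n -natr1 natrM.
have N1 : 1 <= N%:R :> R by rewrite ler1n.
(* From [q ^+ 2 = 4 * p ^+ 2 + 1] and [1 <= p ^+ 2], [q] lies between [2 * p] and [3 * p], where
   [6 * p * (q - p) - q ^+ 2] is nonnegative. *)
have qp : 2 * p <= q by rewrite -ler_sqr ?nnegrE; nra.
have qp' : q <= 3 * p by rewrite -ler_sqr ?nnegrE; nra.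
rewrite -q2 opprK -subr_ge0.
have -> : - (L * p * B / q ^+ 2) + L * B / q - L * B / (6 * p) =
  L * B * (6 * p * (q - p) - q ^+ 2) / (6 * p * q ^+ 2) by field; rewrite !gt_eqF.
rewrite divr_ge0 ?mulr_ge0 ?sqr_ge0 ?(ltW L_gt0) ?(ltW B_gt0) ?(ltW p0) ?(ltW q0)//.
by have := mulr_ge0 (ltW p0) (ltW q0); nra.
Qed.

End statistical_bound.

(** * Random blocks *)

Section cosh_bound.
Context {R : realType}.
Implicit Types c u : R.

Lemma inv_1B_le_expR u : 0 <= u <= 1 / 2 -> (1 - u)^-1 <= expR (2 * u).
Proof.
move=> /andP[u0 u1]; apply: le_trans (expR_ge1Dx _).
have u2 : 0 < 1 - u by lra.
by rewrite -[leLHS]mul1r ler_pdivrMr//; nra.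
Qed.

(** For [c ^+ 2 > 1 / 2] both exponents are below [2 * c ^+ 2]. Otherwise [expR y <= (1 - y)^-1] at
    [c] and [- c] sums to [2 / (1 - c ^+ 2)]. *)
Lemma cosh_le_expR_sqr c : expR c + expR (- c) <= 2 * expR (2 * c ^+ 2).
Proof.
wlog c0 : c / 0 <= c.
  move=> h; have [|/ltW c0] := lerP 0 c; first exact: h.
  by have := h (- c); rewrite opprK sqrrN addrC; apply; rewrite oppr_ge0.
have [c1|c1] := lerP (c ^+ 2) (1 / 2); last first.
  have h1 : expR c <= expR (2 * c ^+ 2) by rewrite ler_expR; nra.
  have h2 : expR (- c) <= expR (2 * c ^+ 2) by rewrite ler_expR; nra.
  by lra.
have c2 : c < 1 by nra.
have inv_le (y : R) : y < 1 -> expR y <= (1 - y)^-1.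
  move=> y1; rewrite -[y in expR y]opprK expRN lef_pV2 ?posrE ?expR_gt0 ?subr_gt0//.
  exact: expR_ge1Dx.
have h1 := inv_le _ c2.
have h2 : expR (- c) <= (1 - - c)^-1 by apply: inv_le; lra.
have h3 : (1 - c ^+ 2)^-1 <= expR (2 * c ^+ 2) by apply: inv_1B_le_expR; rewrite sqr_ge0.
have e : (1 - c)^-1 + (1 - - c)^-1 = 2 * (1 - c ^+ 2)^-1.
  have a1 : 0 < 1 - c by lra.
  have a2 : 0 < 1 - - c by lra.
  have a3 : 0 < 1 - c ^+ 2 by lra.
  by field; rewrite !gt_eqF//; lra.
by lra.
Qed.

End cosh_bound.

Lemma sum_block k n r : (r < n)%N -> (\sum_(j < n * k) (j %/ k == r) = k)%N.
Proof.
case: k => [|k] rn; first by rewrite muln0 big_ord0.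
rewrite -(big_mkord xpredT (fun j => nat_of_bool (j %/ k.+1 == r)%N)) big_nat_mul.
rewrite (big_mkord xpredT (fun i => \sum_(i * k.+1 <= j < i.+1 * k.+1) (j %/ k.+1 == r))%N).
have blockE (i j : nat) : (i * k.+1 <= j < i.+1 * k.+1)%N -> (j %/ k.+1)%N = i.
  move=> /andP[h1 h2]; apply/eqP; rewrite eqn_leq -ltnS ltn_divLR// h2.
  by rewrite leq_divRL.
rewrite (bigD1 (Ordinal rn))//= [X in (_ + X)%N]big1 ?addn0; last first.
  move=> i ir; rewrite big_nat big1// => j /blockE ->.
  by case: eqP => // e; move: ir; rewrite -val_eqE/= e eqxx.
rewrite big_nat (eq_bigr (fun=> 1%N)); last by move=> j /blockE ->; rewrite eqxx.
by rewrite -big_nat sum_nat_const_nat muln1 mulSn addnK.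
Qed.

Section random_blocks.
Context {R : realType}.
Variables (n k : nat).
Hypothesis k_gt0 : (0 < k)%N.
Local Notation signs := {ffun 'I_(n * k) -> bool}.
Implicit Types (s a : signs) (r : nat).

Definition block_vec s r : vec R (n * k) :=
  \row_j (if (j %/ k == r)%N then sgnb (s j) / Num.sqrt k%:R else 0).

Let k0 : 0 < k%:R :> R. Proof. by rewrite ltr0n. Qed.

Let sqrtk_sqr : Num.sqrt k%:R ^+ 2 = k%:R :> R.
Proof. by rewrite sqr_sqrtr// ltW. Qed.

(** Indices [r >= n] name empty blocks and give the zero vector, so the bound holds for all [r], as
    the chain lemmas require. *)
Lemma enorm_block_vec s r : enorm (block_vec s r) <= 1.
Proof.
rewrite /enorm -[leRHS]sqrtr1 ler_wsqrtr//.
have -> : \sum_i block_vec s r ord0 i ^+ 2 = (\sum_(i < n * k) (i %/ k == r))%N%:R / k%:R.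
  rewrite natr_sum mulr_suml; apply: eq_bigr => j _; rewrite mxE.
  case: ifP => _; last by rewrite expr0n mul0r.
  by rewrite expr_div_n sgnb_sqr sqrtk_sqr.
rewrite ler_pdivrMr// mul1r ler_nat.
have [rn|nr] := ltnP r n; first by rewrite sum_block.
rewrite big1// => j _; case: eqP => // jr.
by move: nr; rewrite -jr leqNgt ltn_divLR// ltn_ord.
Qed.

Lemma eq_block_vec s s' r : (forall j : 'I_(n * k), (j %/ k = r)%N -> s j = s' j) ->
  block_vec s r = block_vec s' r.
Proof. by move=> h; apply/rowP => j; rewrite !mxE; case: eqP => // /h ->. Qed.

(** Confines a flip to block [r]: for random [a], [flip (mask r a) s] resamples the signs of this
    block only. *)
Definition mask r a : signs := [ffun j => a j && (j %/ k == r)%N].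

(** Resampling block [r] by an independent [a] leaves [X] fixed, so the sum over [a] factors over
    coordinates and each factor obeys the cosh bound. Coordinates outside the block contribute a
    factor 2. *)
Lemma hoeffding_blocks (X : signs -> vec R (n * k)) r lambda B :
  (forall s a, X (flip (mask r a) s) = X s) -> (forall s, enorm (X s) <= B) ->
  \sum_s expR (lambda * dotv (block_vec s r) (X s)) <=
  #|{: signs}|%:R * expR (2 * lambda ^+ 2 * B ^+ 2 / k%:R).
Proof.
move=> Xinv XB; pose F s := expR (lambda * dotv (block_vec s r) (X s)).
rewrite -[leLHS]/(\sum_s F s).
have S0 : 0 < #|{: signs}|%:R :> R by rewrite ltr0n; apply/card_gt0P; exists [ffun=> false].
rewrite -(ler_pM2l S0).
have -> : #|{: signs}|%:R * \sum_s F s = \sum_s \sum_a F (flip (mask r a) s).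
  rewrite exchange_big/= mulr_natl -sumr_const; apply: eq_bigr => a _.
  exact: sum_flip.
have -> : #|{: signs}|%:R * (#|{: signs}|%:R * expR (2 * lambda ^+ 2 * B ^+ 2 / k%:R)) =
    \sum_(s : signs) #|{: signs}|%:R * expR (2 * lambda ^+ 2 * B ^+ 2 / k%:R).
  by rewrite sumr_const mulr_natl.
apply: ler_sum => s _.
pose c j := lambda * block_vec s r ord0 j * X s ord0 j.
have FE (a : signs) : F (flip (mask r a) s) = \prod_j expR (c j * sgnb (a j)).
  rewrite /F Xinv -expR_sum; congr expR.
  rewrite mulr_sumr; apply: eq_bigr => j _; rewrite /c !mxE !ffunE.
  case: ifP => jr; last by rewrite !(mulr0, mul0r).
  by rewrite jr andbT sgnb_addb; ring.
rewrite (eq_bigr _ (fun a _ => FE a)) -(bigA_distr_bigA (fun j b => expR (c j * sgnb b))).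
apply: (@le_trans _ _ (\prod_(j < n * k) (2 * expR (2 * c j ^+ 2)))).
  apply: ler_prod => j _; apply/andP; split.
    by apply: sumr_ge0 => b _; exact: expR_ge0.
  rewrite big_bool/= /sgnb expr1 expr0 mulr1 mulrN1 addrC.
  exact: cosh_le_expR_sqr.
rewrite big_split/= prodr_const card_ord card_ffun card_bool card_ord natrX.
rewrite ler_wpM2l ?exprn_ge0// -expR_sum ler_expR -mulr_sumr -!mulrA ler_wpM2l//.
apply: (@le_trans _ _ (\sum_j lambda ^+ 2 / k%:R * X s ord0 j ^+ 2)).
  apply: ler_sum => j _; rewrite /c !exprMn ler_wpM2r ?sqr_ge0// ler_wpM2l ?sqr_ge0// mxE.
  case: ifP => _; first by rewrite expr_div_n sgnb_sqr sqrtk_sqr div1r.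
  by rewrite expr0n invr_ge0 ltW.
have -> : lambda * (lambda * (B * (B / k%:R))) = lambda ^+ 2 / k%:R * B ^+ 2 by ring.
rewrite -mulr_sumr ler_wpM2l ?divr_ge0 ?sqr_ge0 ?(ltW k0)//.
have -> : \sum_i X s ord0 i ^+ 2 = enorm (X s) ^+ 2.
  by rewrite enorm_sqr; apply: eq_bigr => i _; rewrite expr2.
by rewrite ler_sqr ?nnegrE ?enorm_ge0// (le_trans (enorm_ge0 (X s))).
Qed.

End random_blocks.

(** * The optimization term *)

Section tail_weight.
Context {R : realType}.
Variables (lambda tau : R).
Hypothesis lambda_ge0 : 0 <= lambda.

(** Chernoff majorant of the indicator of [tau < |y|], covering both tails at once. *)
Definition tail_weight (y : R) : R :=
  expR (- (lambda * tau)) * (expR (lambda * y) + expR (- lambda * y)).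

Lemma tail_weight_ge0 y : 0 <= tail_weight y.
Proof. by rewrite mulr_ge0 ?addr_ge0 ?expR_ge0. Qed.

Lemma tail_weight_ge1 y : tau < `|y| -> 1 <= tail_weight y.
Proof.
move=> hy; rewrite /tail_weight mulrDr -!expRD.
have l0 := lambda_ge0.
have [y0|y0] := lerP 0 y.
  rewrite ler_wpDr ?expR_ge0// -expR0 ler_expR.
  by move: hy; rewrite ger0_norm// => hy; nra.
rewrite ler_wpDl ?expR_ge0// -expR0 ler_expR.
by move: hy; rewrite ltr0_norm// => hy; nra.
Qed.

Lemma sum_tail_weight_le n k (X : {ffun 'I_(n * k) -> bool} -> vec R (n * k)) r B :
  (0 < k)%N ->
  (forall s a, X (flip (mask r a) s) = X s) -> (forall s, enorm (X s) <= B) ->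
  \sum_s tail_weight (dotv (block_vec s r) (X s)) <=
  2 * expR (2 * lambda ^+ 2 * B ^+ 2 / k%:R - lambda * tau) *
    #|{: {ffun 'I_(n * k) -> bool}}|%:R.
Proof.
move=> k0 Xinv XB; rewrite -mulr_sumr big_split/=.
have h1 := hoeffding_blocks k0 lambda Xinv XB.
have h2 := hoeffding_blocks k0 (- lambda) Xinv XB.
rewrite sqrrN in h2; rewrite addrC expRD.
have := ler_wpM2l (expR_ge0 (- (lambda * tau))) (lerD h1 h2).
set E := expR (2 * _ * _ / _); lra.
Qed.

End tail_weight.

(** * The hard chain and the simulation of a run by truncated oracles *)

Section optimization_bound.
Context {R : realType} (N D k : nat) (B amp tau : R).
Hypotheses (k_gt0 : (0 < k)%N) (tau_gt0 : 0 < tau) (amp_ge0 : 0 <= amp).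
Local Notation dim := (D.+1 * k)%N.
Local Notation signs := {ffun 'I_dim -> bool}.
Implicit Types (s : signs) (x : vec R dim).

Definition level_fun n s x : R := amp * chain tau (2 * tau) (block_vec s) n 0 x.
Definition level_grad n s x : vec R dim :=
  amp *: chain_grad tau (2 * tau) (block_vec s) n 0 x.
Definition hard_fun s x (z : nat) := level_fun D s x.
Definition hard_grad s x (z : nat) := level_grad D s x.

Lemma level_fun_local n s s' : (forall j : 'I_dim, (j %/ k <= n)%N -> s j = s' j) ->
  level_fun n s = level_fun n s' /\ level_grad n s = level_grad n s'.
Proof.
move=> h; have [|h1 h2] := @chain_local R dim tau (2 * tau) (block_vec s) (block_vec s') n 0.
  by move=> r rn; apply: eq_block_vec => j jr; apply: h; rewrite jr.
by split; apply/funext => x; rewrite ?/level_fun ?/level_grad ?h1 ?h2.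
Qed.

(** The offset [2 * tau] absorbs two errors of size [tau]: for [r > n], piece [r] is at most
    [tau - 2 * tau * r], hence at most [- tau - 2 * tau * n], which is below piece [n]. *)
Lemma level_fun_truncate n s x : (n <= D)%N ->
  (forall r, (n <= r <= D)%N -> `|dotv (block_vec s r) x| <= tau) ->
  level_fun D s x = level_fun n s x /\ level_grad D s x = level_grad n s x.
Proof.
move=> nD h; have t0 := tau_gt0.
have [|h1 h2] := @chain_truncate R dim tau (2 * tau) (block_vec s) tau_gt0 n (D - n) 0 x.
  rewrite add0n subnKC// => r /andP[nr rD].
  have := h r; rewrite (ltnW nr) rD => /(_ isT); have := h n; rewrite leqnn nD => /(_ isT).
  rewrite !ler_norml /affine_piece => /andP[a1 a2] /andP[b1 b2].
  have : n%:R + 1 <= r%:R :> R by rewrite natr1 ler_nat.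
  nra.
by rewrite subnKC// in h1 h2; rewrite /level_fun /level_grad h1 h2.
Qed.

Lemma hard_in_class L (H : \bar R) s : amp <= L ->
  (forall h : R, H = h%:E -> amp * (16 / tau) <= h) ->
  in_class L B H (hard_fun s) (hard_grad s).
Proof.
move=> aL aH z; set M := chain tau (2 * tau) (block_vec s) D 0.
have v1 r : enorm (block_vec s r) <= 1 :> R by exact: enorm_block_vec.
have lower := chain_lower (2 * tau) (block_vec s) tau_gt0 D 0.
split.
- move=> x y _ _; rewrite -mulrBr normrM ger0_norm//.
  by apply: ler_pM => //; exact: chain_lipschitz.
- move=> x y t _ _ t01; rewrite /hard_fun /level_fun !(mulrCA _ amp) -mulrDr ler_wpM2l//.
  exact: (subgradient_convex lower).
- by move=> x y _ _; rewrite dotvZl -mulrDr ler_wpM2l.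
- move=> h Hh; split.
    (* [amp] may be 0, hence the division by [amp + 1]. *)
    move=> x _ e e0; have e1 : 0 < e / (amp + 1).
      by rewrite divr_gt0//; have := amp_ge0; lra.
    have [d d0 hd] := chain_is_gradient (2 * tau) tau_gt0 v1 D 0 x e1.
    exists d => // y /hd; rewrite /hard_fun /hard_grad /level_fun /level_grad dotvZl -!mulrBr normrM ger0_norm//.
    have a0 := amp_ge0; move=> /(ler_wpM2l a0) /le_trans; apply.
    rewrite !mulrA ler_wpM2r ?enorm_ge0// ler_pdivrMr; nra.
  move=> x y _ _; rewrite -scalerBr enormZ ger0_norm//.
  apply: le_trans (ler_wpM2r (enorm_ge0 _) (aH _ Hh)).
  by rewrite -mulrA ler_wpM2l// chain_grad_lipschitz.
Qed.

Lemma measurable_hard s : measurable_fun setT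
  (fun p : vec R dim * nat => (hard_fun s p.1 p.2, hard_grad s p.1 p.2)).
Proof.
apply: measurable_fun_pair.
  apply: measurable_funM => //.
  exact: (measurableT_comp (measurable_chain tau_gt0 (2 * tau) (block_vec s) D 0) measurable_fst).
apply: measurable_scalev => //.
exact: (measurableT_comp (measurable_chain_grad tau_gt0 (2 * tau) (block_vec s) D 0) measurable_fst).
Qed.

Lemma norm_hard_fun_le s x z : enorm x <= B ->
  `|hard_fun s x z| <= amp * (`|chain tau (2 * tau) (block_vec s) D 0 0| + B).
Proof.
move=> xB; rewrite normrM ger0_norm// ler_wpM2l//.
have v1 r : enorm (block_vec s r) <= 1 :> R by exact: enorm_block_vec.
have := chain_lipschitz (2 * tau) tau_gt0 v1 D 0 x 0; rewrite subr0.
set c0 := chain _ _ _ _ _ 0; set c := chain _ _ _ _ _ x => h.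
have -> : c = c0 + (c - c0) by ring.
by apply: le_trans (ler_normD _ _) _; rewrite lerD2l (le_trans h).
Qed.

(** At the point opposing all signs, every block has inner product [- (B / Num.sqrt D.+1%:R)], and
    the chain never exceeds the maximum of its pieces. *)
Lemma hard_fun_opt s z : 0 <= B ->
  exists2 y, enorm y <= B & hard_fun s y z <= amp * - (B / Num.sqrt D.+1%:R).
Proof.
move=> B0; pose w := B / Num.sqrt (D.+1%:R * k%:R).
have k0 : 0 < k%:R :> R by rewrite ltr0n.
have D0 : 0 < D.+1%:R :> R by rewrite ltr0n.
exists (\row_j (- w * sgnb (s j))).
  rewrite /enorm; under eq_bigr do rewrite mxE exprMn sgnb_sqr mulr1 sqrrN.
  rewrite sumr_const card_ord -[_ *+ dim]mulr_natr /w expr_div_n sqr_sqrtr ?mulr_ge0//.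
  by rewrite natrM mulfVK ?gt_eqF ?mulr_gt0// sqrtr_sqr ger0_norm.
rewrite ler_wpM2l//; apply: chain_le => // r /andP[_]; rewrite add0n -ltnS => rD.
apply: (@le_trans _ _ (dotv (block_vec s r) (\row_j (- w * sgnb (s j))))).
  by rewrite gerBl !mulr_ge0// ltW.
have -> : dotv (block_vec s r) (\row_j (- w * sgnb (s j))) =
    \sum_(j < dim) (j %/ k == r)%N%:R * (- w / Num.sqrt k%:R).
  apply: eq_bigr => j _; rewrite !mxE; case: ifP => _; last by rewrite !mul0r.
  by rewrite mul1r mulrACA; transitivity (sgnb (s j) ^+ 2 * (- w / Num.sqrt k%:R) : R); [ring|rewrite sgnb_sqr mul1r].
rewrite -mulr_suml -natr_sum sum_block// /w sqrtrM ?(ltW D0)// le_eqVlt; apply/orP; left; apply/eqP.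
have e : k%:R = Num.sqrt k%:R ^+ 2 :> R by rewrite sqr_sqrtr// ltW.
by rewrite {1}e; field; rewrite !gt_eqF ?sqrtr_gt0.
Qed.

Context {dX : measure_display} {Xi : measurableType dX} (G : rel 'I_N).
Variables (Rule : 'I_N -> hist R N dim -> Xi -> vec R dim)
  (Xhat : hist R N dim -> Xi -> vec R dim) (lev : 'I_N -> nat).
Hypotheses (B_ge0 : 0 <= B) (D_gt0 : (0 < D)%N)
  (Rule_ball : forall t h xi, enorm (Rule t h xi) <= B)
  (Xhat_ball : forall h xi, enorm (Xhat h xi) <= B)
  (Rule_local : forall t (h h' : hist R N dim) xi,
     (forall u, ancestor G u t -> tnth h u = tnth h' u) -> Rule t h xi = Rule t h' xi)
  (lev_lt : forall u t, ancestor G u t -> (lev u < lev t)%N)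
  (lev_ltD : forall t, (lev t < D)%N).
Variables (lambda : R) (xi : Xi) (zs : 'I_N -> nat).
Hypothesis lambda_ge0 : 0 <= lambda.

(** Idealized oracle: node [t] sees the chain cut after block [lev t]. [Q] and [Y] are the queries
    and output it produces, [X] the output of the actual run. *)
Let T s (t : 'I_N) x := (level_fun (lev t) s x, level_grad (lev t) s x).
Let Q s i t := orun Rule (T s) xi i t.
Let Y s := ooutput Rule Xhat (T s) xi.
Let X s := output Rule Xhat (hard_fun s) (hard_grad s) xi zs.

Let T_flip s a r t : (lev t < r)%N -> T (flip (mask r a) s) t = T s t.
Proof.
move=> tr; have [|h1 h2] := @level_fun_local (lev t) (flip (mask r a) s) s.
  move=> j jt; rewrite !ffunE; case: eqP => [jr|_]; last by rewrite andbF addbF.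
  by move: tr; rewrite -jr ltnNge jt.
by rewrite /T h1 h2.
Qed.

(** The ancestors of [t] have levels below [r], so their truncated answers do not involve block
    [r]. *)
Let Q_flip s a r i t : (lev t <= r)%N -> Q (flip (mask r a) s) i t = Q s i t.
Proof.
move=> tr; apply: (@eq_orun_level _ _ _ _ _ Rule G lev _ _ xi (lev t)) => // u ut.
by apply/funext => x; rewrite (T_flip _ _ (leq_trans ut tr)).
Qed.

Let Y_flip s a : Y (flip (mask D a) s) = Y s.
Proof.
rewrite /Y; congr ooutput; apply/funext => t; exact: T_flip.
Qed.

(* The union bound ranges over all rounds i of the iteration that defines run,
   so that no stabilization argument is needed. *)
Let W s : R :=
  \sum_(i < N.+1) \sum_t \sum_(r < D.+1 | (lev t <= r)%N)
    tail_weight lambda tau (dotv (block_vec s r) (Q s i t))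
  + tail_weight lambda tau (dotv (block_vec s D) (Y s)).

Let W_ge0 s : 0 <= W s.
Proof.
rewrite addr_ge0 ?tail_weight_ge0//; apply: sumr_ge0 => i _; apply: sumr_ge0 => t _.
by apply: sumr_ge0 => r _; exact: tail_weight_ge0.
Qed.

(** All tail weights are below 1, so all inner products are within [tau]; the truncated answers then
    equal the true ones along the idealized run. *)
Let sim s : W s < 1 -> X s = Y s /\ `|dotv (block_vec s D) (Y s)| <= tau.
Proof.
have tw0 := tail_weight_ge0 lambda tau.
move=> W1; have small (y : R) : tail_weight lambda tau y <= W s -> `|y| <= tau.
  move=> yW; rewrite leNgt; apply/negP => /(tail_weight_ge1 lambda_ge0) h.
  by have := le_lt_trans (le_trans h yW) W1; rewrite ltxx.
split; last first.
  apply: small; rewrite lerDr; apply: sumr_ge0 => i _; apply: sumr_ge0 => t _.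
  by apply: sumr_ge0 => r _.
(* The equality is reversed because agreement of the oracles is known along the run of [T s]. *)
rewrite /X outputE; apply/esym; apply: eq_ooutput => i t iN.
have [|h1 h2] := @level_fun_truncate (lev t) s (Q s i t) (ltnW (lev_ltD t)).
  move=> r /andP[tr]; rewrite -ltnS => rD; apply: small.
  have iN' : (i < N.+1)%N by [].
  rewrite /W (bigD1 (Ordinal iN'))//= (bigD1 t)//= (bigD1 (Ordinal rD))//= -!addrA lerDl.
  rewrite !addr_ge0//.
  - by apply: sumr_ge0.
  - by apply: sumr_ge0 => t' _; apply: sumr_ge0.
  - by apply: sumr_ge0 => i' _; apply: sumr_ge0 => t' _; apply: sumr_ge0.
by rewrite /hard_fun /hard_grad h1 h2.
Qed.

Lemma sum_hard_fun_ge :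
  (amp * - (4 * D%:R * tau + B * (2 * ((N.+1 * N * D.+1).+1)%:R *
     expR (2 * lambda ^+ 2 * B ^+ 2 / k%:R - lambda * tau)))) * #|{: signs}|%:R
  <= \sum_s hard_fun s (X s) 0%N.
Proof.
set E := expR _; set S := #|_|%:R; set M := (N.+1 * N * D.+1)%N.
have Dk0 := tau_gt0; have D1 : 1 <= D%:R :> R by rewrite ler1n.
have pointwise s : amp * - (4 * D%:R * tau + B * W s) <= hard_fun s (X s) 0%N.
  rewrite ler_wpM2l//; have BW : 0 <= B * W s by rewrite mulr_ge0.
  have [/sim[-> ]|W1] := ltrP (W s) 1.
    (* The last piece is at least [- tau - 2 * D%:R * tau] and the nesting loses at most
       [D%:R * tau]; in all at most [4 * D%:R * tau]. *)
    rewrite ler_norml => /andP[h _].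
    have := chain_ge (2 * tau) (block_vec s) tau_gt0 D 0 (Y s).
    by rewrite /affine_piece add0n; nra.
  (* On the bad event the first piece gives at least [- B], which [B * W s] covers since
     [1 <= W s]. *)
  apply: le_trans (chain_ge_head _ _ tau_gt0 _ _ _); rewrite /affine_piece mul0r subr0.
  have := norm_dotv_le (block_vec s 0) (X s); rewrite ler_norml => /andP[h _].
  have XB : enorm (X s) <= B by exact: Xhat_ball.
  have vB : enorm (block_vec s 0) <= 1 :> R by exact: enorm_block_vec.
  have X0 := enorm_ge0 (X s).
  have : enorm (block_vec s 0) * enorm (X s) <= B.
    by rewrite (le_trans _ XB)// -[leRHS]mul1r ler_wpM2r.
  have : B <= B * W s by rewrite -[leLHS]mulr1 ler_wpM2l.
  have : 0 <= 4 * D%:R * tau by rewrite !mulr_ge0// ltW.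
  lra.
have tailQ i t (r : 'I_D.+1) : (lev t <= r)%N ->
    \sum_s tail_weight lambda tau (dotv (block_vec s r) (Q s i t)) <= 2 * E * S.
  move=> tr; apply: (sum_tail_weight_le lambda tau k_gt0 (fun s a => Q_flip s a i tr)) => s.
  exact: orun_bounded.
have ES0 : 0 <= 2 * E * S by rewrite !mulr_ge0 ?expR_ge0.
have sumW : \sum_s W s <= M.+1%:R * (2 * E * S).
  rewrite big_split/= -natr1 mulrDl mul1r; apply: lerD; last first.
    by apply: (sum_tail_weight_le lambda tau k_gt0 Y_flip) => s; exact: Xhat_ball.
  rewrite exchange_big/= /M -mulnA natrM -mulrA.
  rewrite -[N.+1 in leRHS]card_ord mulr_natl -sumr_const; apply: ler_sum => i _.
  rewrite exchange_big/= natrM -mulrA.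
  rewrite -[N in leRHS]card_ord mulr_natl -sumr_const; apply: ler_sum => t _.
  rewrite exchange_big/=.
  rewrite -[D.+1 in leRHS]card_ord mulr_natl -sumr_const big_mkcond/=; apply: ler_sum => r _.
  by case: ifP => // tr; exact: tailQ.
apply: le_trans (ler_sum _ (fun s _ => pointwise s)).
rewrite -mulr_sumr -mulrA ler_wpM2l// sumrN mulNr lerN2.
rewrite big_split/= sumr_const -mulr_sumr.
have := ler_wpM2l B_ge0 sumW; rewrite -[_ *+ #|_|]mulr_natr -/S; lra.
Qed.

End optimization_bound.

(** * Choice of the parameters *)

Section optimization_instance.
Context {R : realType} (N D : nat) (B amp : R).
Hypotheses (D_gt0 : (0 < D)%N) (DN : (D <= N)%N) (B_gt0 : 0 < B) (amp_ge0 : 0 <= amp).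

Let l : R := ln (D * N)%:R.

Let DR : 1 <= D%:R :> R. Proof. by rewrite ler1n. Qed.
Let NR : 1 <= N%:R :> R. Proof. by rewrite ler1n (leq_trans D_gt0). Qed.
Let l_ge0 : 0 <= l.
Proof. by rewrite ln_ge0// natrM; have := DR; have := NR; nra. Qed.

(** With the chosen [lambda] the tail exponent is [- k / (2048 * D ^ 3)] for block size [k]; the
    factor 160 makes it at most [- 160 - 2 * l]. *)
Definition block_size : nat := (Num.truncn (2048 * 160 * (D%:R ^+ 3 * (1 + l)) : R)).+1.

(** Chosen so that the loss [4 * D%:R * tau] equals [B / (4 * Num.sqrt D%:R)], a quarter of the
    scale of the optimum. *)
Definition hard_tau : R := B / (16 * D%:R * Num.sqrt D%:R).

Let sqrtD_gt0 : 0 < Num.sqrt D%:R :> R.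
Proof. by rewrite sqrtr_gt0 ltr0n. Qed.

Let sqrtD_sqr : Num.sqrt D%:R ^+ 2 = D%:R :> R.
Proof. by rewrite sqr_sqrtr. Qed.

Lemma hard_tau_gt0 : 0 < hard_tau.
Proof. by rewrite divr_gt0// !mulr_gt0// ltr0n. Qed.

Let K0_ge1 : 1 <= D%:R ^+ 3 * (1 + l).
Proof.
rewrite -[leLHS]mulr1; apply: ler_pM => //; last by rewrite lerDl.
by rewrite exprn_ege1.
Qed.

Let K0_ge0 : 0 <= 2048 * 160 * (D%:R ^+ 3 * (1 + l)).
Proof. by have := K0_ge1; lra. Qed.

Lemma block_size_ge : 2048 * 160 * (D%:R ^+ 3 * (1 + l)) <= block_size%:R.
Proof. by have /andP[_ /ltW] := truncn_itv K0_ge0. Qed.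

Lemma block_size_le : block_size%:R <= (2048 * 160 + 1) * (D%:R ^+ 3 * (1 + l)).
Proof.
have /andP[h _] := truncn_itv K0_ge0.
by rewrite /block_size -natr1; have := K0_ge1; lra.
Qed.

(** The minimizer of the exponent [2 * lambda ^+ 2 * B ^+ 2 / k - lambda * tau]. *)
Let lambda : R := hard_tau * block_size%:R / (4 * B ^+ 2).

Let tail_le : B * (2 * ((N.+1 * N * D.+1).+1)%:R *
     expR (2 * lambda ^+ 2 * B ^+ 2 / block_size%:R - lambda * hard_tau))
  <= B / (16 * Num.sqrt D%:R).
Proof.
have B0 := B_gt0; have s0 := sqrtD_gt0; have D1 := DR; have N1 := NR; have l0 := l_ge0.
have D0 : 0 < D%:R :> R by rewrite ltr0n.
have N0 : 0 < N%:R :> R by lra.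
have k0 : 0 < block_size%:R :> R by rewrite ltr0n.
have -> : 2 * lambda ^+ 2 * B ^+ 2 / block_size%:R - lambda * hard_tau =
    - (block_size%:R / (2048 * D%:R ^+ 2 * Num.sqrt D%:R ^+ 2)).
  by rewrite /lambda /hard_tau; field; rewrite !gt_eqF.
have -> : 2048 * D%:R ^+ 2 * Num.sqrt D%:R ^+ 2 = 2048 * D%:R ^+ 3 :> R.
  by rewrite sqrtD_sqr; ring.
have hexp : expR (- (block_size%:R / (2048 * D%:R ^+ 3))) <= 161^-1 / (D%:R * N%:R) ^+ 2 :> R.
  have D3 : 0 < 2048 * D%:R ^+ 3 :> R by have := exprn_gt0 3 D0; lra.
  apply: (@le_trans _ _ (expR (- 160 + - (2 * l)))).
    rewrite ler_expR -opprD lerN2 ler_pdivlMr//.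
    apply: le_trans block_size_ge.
    have : 0 <= D%:R ^+ 3 * l :> R by rewrite mulr_ge0.
    by nra.
  rewrite expRD !expRN; apply: ler_pM; rewrite ?invr_ge0 ?expR_ge0//.
    rewrite lef_pV2 ?posrE ?expR_gt0//; apply: le_trans (expR_ge1Dx _); lra.
  by rewrite mulr_natl mulr2n expRD /l lnK ?natrM ?posrE ?mulr_gt0// -expr2.
(* The number of tail events, at most [5 * N ^ 2 * D], is beaten by [(D * N) ^ 2] from [l]; what
   remains is [10 / (161 * D)], below [1 / (16 * D)]. *)
have hM : ((N.+1 * N * D.+1).+1)%:R <= 5 * N%:R ^+ 2 * D%:R :> R.
  rewrite -natr1 !natrM -(natr1 N) -(natr1 D).
  have a1 : 1 <= N%:R ^+ 2 :> R by rewrite exprn_ege1.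
  have a2 : 1 <= N%:R ^+ 2 * D%:R :> R by rewrite -[leLHS]mulr1 ler_pM.
  have a3 : (N%:R + 1) * N%:R <= 2 * N%:R ^+ 2 :> R by nra.
  have a4 : (N%:R + 1) * N%:R * (D%:R + 1) <= 2 * N%:R ^+ 2 * (2 * D%:R) :> R.
    by apply: ler_pM; rewrite ?mulr_ge0 ?addr_ge0//; lra.
  lra.
have e : 5 * N%:R ^+ 2 * D%:R * (161^-1 / (D%:R * N%:R) ^+ 2) = 5 / (161 * D%:R) :> R.
  by field; rewrite !gt_eqF.
have h : ((N.+1 * N * D.+1).+1)%:R * expR (- (block_size%:R / (2048 * D%:R ^+ 3)))
   <= 5 / (161 * D%:R) :> R.
  by rewrite -e; exact: (ler_pM (ler0n _ _) (expR_ge0 _) hM hexp).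
have hD : D%:R^-1 <= (Num.sqrt D%:R)^-1 :> R.
  have s1 : 1 <= Num.sqrt D%:R :> R by rewrite -[leLHS]sqrtr1 ler_wsqrtr.
  by rewrite lef_pV2 ?posrE//; have := sqrtD_sqr; nra.
rewrite ler_wpM2l ?(ltW B0)// -mulrA.
apply: (@le_trans _ _ (2 * (5 / (161 * D%:R)))); first by rewrite ler_wpM2l.
have hD0 : 0 <= D%:R^-1 :> R by rewrite invr_ge0.
rewrite !invfM; lra.
Qed.

Lemma optimization_lower_bound {dX} {Xi : measurableType dX}
    (G : rel 'I_N) (mu : probability Xi R)
    (Rule : 'I_N -> hist R N (D.+1 * block_size) -> Xi -> vec R (D.+1 * block_size))
    (Xhat : hist R N (D.+1 * block_size) -> Xi -> vec R (D.+1 * block_size)) :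
  has_depth G D ->
  (forall t h xi, enorm (Rule t h xi) <= B) ->
  (forall h xi, enorm (Xhat h xi) <= B) ->
  (forall t h h' xi,
     (forall u, ancestor G u t -> tnth h u = tnth h' u) -> Rule t h xi = Rule t h' xi) ->
  (forall t, measurable_fun setT (fun p : hist R N _ * Xi => Rule t p.1 p.2)) ->
  measurable_fun setT (fun p : hist R N _ * Xi => Xhat p.1 p.2) ->
  exists s, ((amp * B / (4 * Num.sqrt D%:R))%:E <=
    expected_loss Rule Xhat (hard_fun amp hard_tau s) (hard_grad amp hard_tau s) mu (uniform_nat 0)
    - opt_value (hard_fun amp hard_tau s) B (uniform_nat 0))%E.
Proof.
move=> /exists_level[lev [lev_lt lev_ltD]] RB XB RL mR mX.
have B0 := B_gt0; have s0 := sqrtD_gt0; have D1 := DR; have N1 := NR; have l0 := l_ge0.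
have D0 : 0 < D%:R :> R by rewrite ltr0n.
have t0 := hard_tau_gt0; have k0 : (0 < block_size)%N by [].
(* [5 / 16] is [1 / 4] from the offsets and nesting plus [1 / 16] from the tails. *)
pose a := amp * - (5 / 16 * (B / Num.sqrt D%:R)); pose b := amp * - (B / Num.sqrt D.+1%:R).
pose c0 s := `|chain hard_tau (2 * hard_tau) (block_vec s) D 0 (0 : vec R (D.+1 * block_size))|.
have [s hs] : exists s, ((a - b)%:E <=
    expected_loss Rule Xhat (hard_fun amp hard_tau s) (hard_grad amp hard_tau s) mu (uniform_nat 0)
    - opt_value (hard_fun amp hard_tau s) B (uniform_nat 0))%E.
  apply: (@exists_hard_instance _ _ _ _ _ _ _ _ _ B a b (amp * (\sum_s c0 s + B))) => //.
  - by apply/card_gt0P; exists [ffun=> false].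
  - by move=> s; exact: measurable_hard.
  - move=> s y i yB; apply: le_trans (norm_hard_fun_le k0 t0 amp_ge0 s i yB) _.
    rewrite ler_wpM2l// lerD2r (bigD1 s)//= lerDl.
    by apply: sumr_ge0 => s' _; exact: normr_ge0.
  - move=> xi zs; under eq_bigr do rewrite big_ord1 divr1.
    have lambda0 : 0 <= lambda.
      by rewrite /lambda divr_ge0// mulr_ge0 ?sqr_ge0 ?(ltW t0) ?ler0n.
    apply: le_trans (sum_hard_fun_ge k0 t0 amp_ge0 (ltW B0) D_gt0 RB XB RL lev_lt lev_ltD xi zs lambda0).
    rewrite ler_wpM2r// ler_wpM2l// lerN2.
    have := tail_le.
    have -> : 4 * D%:R * hard_tau = B / (4 * Num.sqrt D%:R).
      by rewrite /hard_tau; field; rewrite !gt_eqF.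
    rewrite !invfM; lra.
  - move=> s; have [y yB yb] := hard_fun_opt k0 t0 amp_ge0 s 0 (ltW B0).
    by exists y => //; rewrite big_ord1 divr1.
exists s; apply: le_trans hs; rewrite lee_fin /a /b.
have q0 : 0 < Num.sqrt D.+1%:R :> R by rewrite sqrtr_gt0 ltr0n.
have q2 : Num.sqrt D.+1%:R ^+ 2 = D%:R + 1 :> R by rewrite sqr_sqrtr// natr1.
have p2 := sqrtD_sqr.
set q := Num.sqrt D.+1%:R in q0 q2 *; set p := Num.sqrt D%:R in s0 p2 *.
(* [49 * (D + 1) <= 100 * D] for [D >= 1]; the gap [7 / 10 - 5 / 16] then exceeds [1 / 4]. *)
have qp : 7 * q <= 10 * p by rewrite -ler_sqr ?nnegrE; nra.
have h : 7 / 10 * (B / p) <= B / q.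
  rewrite -subr_ge0; have -> : B / q - 7 / 10 * (B / p) = B * (10 * p - 7 * q) / (10 * p * q).
    by field; rewrite !gt_eqF.
  by rewrite divr_ge0 ?mulr_ge0 ?(ltW B0) ?(ltW s0) ?(ltW q0)//; lra.
have Bp : 0 <= B / p by rewrite divr_ge0 ?ltW.
have -> : amp * B / (4 * p) = amp * (1 / 4 * (B / p)) by field; rewrite gt_eqF.
by rewrite -mulrBr ler_wpM2l//; lra.
Qed.

End optimization_instance.

(** * Choice of the amplitude and comparison of the two bounds *)

Theorem theorem1 (R : realType) :
  exists c0 C : R, 0 < c0 /\ 0 < C /\
  forall (L B : R) (H : \bar R) (N D : nat) (G : rel 'I_N),
    0 < L -> 0 < B -> (0 <= H)%E -> (1 <= D)%N -> (D <= N)%N ->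
    dag G -> has_depth G D ->
  forall (dX : measure_display) (Xi : measurableType dX)
    (mu : probability Xi R)
    (Rule : forall m : nat, 'I_N -> hist R N m -> Xi -> vec R m)
    (Xhat : forall m : nat, hist R N m -> Xi -> vec R m),
    is_algorithm G B Rule Xhat ->
  exists (m : nat) (dZ : measure_display) (Z : measurableType dZ)
    (P : probability Z R) (f : vec R m -> Z -> R) (g : vec R m -> Z -> vec R m),
  [/\ m%:R <= C * (maxn (N ^ 2) (D ^ 3 * N))%:R * (1 + ln (D * N)%:R),
      in_class L B H f g,
      measurable_fun setT (fun p : vec R m * Z => (f p.1 p.2, g p.1 p.2)),
      (forall x, eball B x -> P.-integrable setT (fun z => (f x z)%:E)) &
      (expected_loss (Rule m) (Xhat m) f g mu P - opt_value f B P >=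
        c0%:E * (Order.min ((L * B / Num.sqrt D%:R)%:E)
                           (H * (B ^+ 2 / D%:R ^+ 2)%:E)
                 + (L * B / Num.sqrt N%:R)%:E))%E].
Proof.
exists (1 / 2048), (1000 * 1000); split; first lra; split; first lra.
move=> L B H N D G L0 B0 H0 D0 DN _ hG dX Xi mu Rule Xhat [RB XB RL mR mX].
have N0 : (0 < N)%N by exact: leq_trans DN.
have D1 : 1 <= D%:R :> R by rewrite ler1n.
have N1 : 1 <= N%:R :> R by rewrite ler1n.
have DR : 0 < D%:R :> R by rewrite ltr0n.
have sD : 0 < Num.sqrt D%:R :> R by rewrite sqrtr_gt0.
have sN : 0 < Num.sqrt N%:R :> R by rewrite sqrtr_gt0; lra.
have sD2 : Num.sqrt D%:R ^+ 2 = D%:R :> R by rewrite sqr_sqrtr// ltW.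
have ln0 : 0 <= ln (D * N)%:R :> R by rewrite ln_ge0// natrM; nra.
pose w : R := L * B / Num.sqrt N%:R.
have w0 : 0 <= w by rewrite divr_ge0 ?mulr_ge0 ?ltW.
(* The amplitude is the largest allowed by both constraints: [L], or [h * hard_tau D B / 16] if
   smoothness binds. In the latter case [1024 = 256 * 4] turns the gap into exactly
   [h * B ^+ 2 / D%:R ^+ 2]. *)
have [amp [amp0 ampL ampH ampmin]] : exists amp : R, [/\ 0 <= amp, amp <= L,
    (forall h : R, H = h%:E -> amp * (16 / hard_tau D B) <= h) &
    (Order.min ((L * B / Num.sqrt D%:R)%:E) (H * (B ^+ 2 / D%:R ^+ 2)%:E)
      <= (1024 * (amp * B / (4 * Num.sqrt D%:R)))%:E)%E].
  have minL : (Order.min ((L * B / Num.sqrt D%:R)%:E) (H * (B ^+ 2 / D%:R ^+ 2)%:E)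
      <= (1024 * (L * B / (4 * Num.sqrt D%:R)))%:E)%E.
    rewrite ge_min lee_fin; apply/orP; left.
    have -> : 1024 * (L * B / (4 * Num.sqrt D%:R)) = 256 * (L * B / Num.sqrt D%:R).
      by field; rewrite gt_eqF.
    have : 0 <= L * B / Num.sqrt D%:R by rewrite divr_ge0 ?mulr_ge0 ?ltW.
    lra.
  case: H H0 minL => [h| |]//= h0 minL; last first.
    by exists L; split=> //; exact: ltW.
  rewrite lee_fin in h0.
  have [hL|Lh] := lerP (h * B / (256 * D%:R * Num.sqrt D%:R)) L.
    exists (h * B / (256 * D%:R * Num.sqrt D%:R)); split=> //.
    - by rewrite divr_ge0 ?mulr_ge0 ?ler0n// ltW.
    - move=> h' [<-]; rewrite /hard_tau le_eqVlt; apply/orP; left; apply/eqP.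
      by field; rewrite !gt_eqF.
    - rewrite ge_min -EFinM !lee_fin; apply/orP; right.
      rewrite le_eqVlt; apply/orP; left; apply/eqP.
      have -> : 1024 * (h * B / (256 * D%:R * Num.sqrt D%:R) * B / (4 * Num.sqrt D%:R)) =
          h * (B ^+ 2 / (D%:R * Num.sqrt D%:R ^+ 2)) by field; rewrite !gt_eqF.
      by rewrite sD2 expr2.
  exists L; split=> //; first exact: ltW.
  move=> h' [<-]; move: Lh; rewrite ltr_pdivlMr ?mulr_gt0 ?ltr0n// => Lh.
  have -> : L * (16 / hard_tau D B) = L * (256 * D%:R * Num.sqrt D%:R) / B.
    by rewrite /hard_tau; field; rewrite !gt_eqF.
  by rewrite ler_pdivrMr// ltW.
pose u : R := amp * B / (4 * Num.sqrt D%:R).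
have u0 : 0 <= u by rewrite divr_ge0 ?mulr_ge0 ?(ltW B0) ?(ltW sD).
(* [1 / 2048 * (1024 * u + w)] is at most [v / 2 + 6 * v / 2048]. *)
have finish v : u <= v -> w / 6 <= v ->
    ((1 / 2048)%:E * (Order.min ((L * B / Num.sqrt D%:R)%:E)
      (H * (B ^+ 2 / D%:R ^+ 2)%:E) + w%:E) <= v%:E)%E.
  move=> uv wv.
  apply: (@le_trans _ _ ((1 / 2048)%:E * ((1024 * u)%:E + w%:E))%E).
    have c0 : 0 <= 1 / 2048 :> R by lra.
    by apply: lee_wpmul2l; [rewrite lee_fin|exact: leeD2r].
  by rewrite -EFinD -EFinM lee_fin; lra.
have [uw|wu] := lerP u (w / 6).
  have [s hs] := statistical_lower_bound L0 B0 N0 mu (XB _) (mR _) (mX _).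
  exists (4 * N).+1, _, nat, (uniform_nat (4 * N)), (coin_fun L s), (coin_grad L s); split.
  - apply: (@le_trans _ _ ((1000 * 1000) * (N ^ 2)%:R)).
      by rewrite natrX -natr1 natrM; nra.
    have C0 : 0 <= 1000 * 1000 :> R by lra.
    rewrite -[leLHS]mulr1; apply: ler_pM; [|exact: ler01| |by rewrite lerDl].
      exact: (mulr_ge0 C0 (ler0n _ _)).
    by apply: (ler_wpM2l C0); rewrite ler_nat leq_maxl.
  - exact: coin_in_class.
  - exact: measurable_coin.
  - move=> x xB; apply: (@bounded_integrable_nat _ _ _ (L * B)) => i.
    rewrite /coin_fun !normrM normr_sign mulr1 gtr0_norm//.
    by rewrite ler_wpM2l ?(ltW L0)// (le_trans (coord_le_enorm _ _)).
  - apply: le_trans hs; apply: finish; rewrite /w ?(le_trans uw)// /w.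
      have -> : L * B / (6 * Num.sqrt N%:R) = L * B / Num.sqrt N%:R / 6 by field; rewrite gt_eqF.
      by [].
    by rewrite le_eqVlt; apply/orP; left; apply/eqP; field; rewrite gt_eqF.
have t0 : 0 < hard_tau D B by exact: hard_tau_gt0.
have k0 : (0 < @block_size R N D)%N by [].
have [s hs] := optimization_lower_bound D0 DN B0 amp0 mu hG (RB _) (XB _) (RL _) (mR _) (mX _).
exists (D.+1 * @block_size R N D)%N, _, nat, (uniform_nat 0),
  (hard_fun amp (hard_tau D B) s), (hard_grad amp (hard_tau D B) s); split.
(* The dimension is of order [D ^ 4 * (1 + l)], with one factor [D] bounded by [N]; the constant
   [2 * (2048 * 160 + 1)] is below [1000 * 1000]. *)
- have kle := @block_size_le R N D D0 DN.
  have m1 : (D.+1 * @block_size R N D)%:R <= 2 * D%:R * ((2048 * 160 + 1) * (D%:R ^+ 3 * (1 + ln (D * N)%:R))) :> R.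
    by rewrite natrM; apply: ler_pM; rewrite ?ler0n// -natr1; lra.
  apply: le_trans m1 _.
  have hmax : D%:R ^+ 3 * N%:R <= (maxn (N ^ 2) (D ^ 3 * N))%:R :> R.
    by rewrite -natrX -natrM ler_nat leq_maxr.
  have DN' : D%:R <= N%:R :> R by rewrite ler_nat.
  have -> : 2 * D%:R * ((2048 * 160 + 1) * (D%:R ^+ 3 * (1 + ln (D * N)%:R))) =
    (2 * (2048 * 160 + 1)) * (D%:R ^+ 3 * D%:R) * (1 + ln (D * N)%:R) :> R by ring.
  rewrite ler_wpM2r ?addr_ge0//.
  have DN3 : D%:R ^+ 3 * D%:R <= D%:R ^+ 3 * N%:R :> R by rewrite ler_wpM2l.
  have D30 : 0 <= D%:R ^+ 3 * D%:R :> R by rewrite mulr_ge0.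
  by lra.
- exact: hard_in_class.
- exact: measurable_hard.
- move=> x xB; apply: bounded_integrable_nat => i.
  exact: (norm_hard_fun_le k0 t0 amp0 s i xB).
- by apply: le_trans hs; apply: finish => //; exact: ltW.
Qed.
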